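(* If $G\in 2^\omega$ is 2-random, then $G$ is not almost everywhere dominating.
   Context: $\mu$ is the fair-coin (Lebesgue) probability measure on $2^\omega$; ''almost all'' means on a set of $\mu$-measure $1$. A Martin-Löf test relative to a set $A$ is a sequence $\langle U_n:n\in\omega\rangle$ of $\Sigma^{0,A}_1$ classes in $2^\omega$, uniform in $A$, with $\mu(U_n)\leq 2^{-n}$ for each $n$. A set $R$ is 2-random if for every Martin-Löf test $\langle U_n\rangle$ relative to $0'$, $R\notin\bigcap_n U_n$. For $f,g\in\omega^\omega$, $f$ dominates $g$ if $\exists m\,\forall n>m\,(f(n)>g(n))$. A set $A$ is almost everywhere (a.e.) dominating if for almost all $X\in 2^\omega$ and all functions $g\leq_T X$, there is a function $f\leq_T A$ such that $f$ dominates $g$. *)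

(* Defs.v *)
From HB Require Import structures.
From Stdlib Require Cantor.
From mathcomp Require Import all_boot all_order all_algebra.
From mathcomp Require Import all_classical all_reals all_analysis.
From mathcomp Require Import measurable_realfun zify lra.

Set Implicit Arguments.
Unset Strict Implicit.
Unset Printing Implicit Defensive.
Import Order.TTheory GRing.Theory Num.Theory.
Import numFieldNormedType.Exports.

Local Open Scope classical_set_scope.
Local Open Scope ring_scope.

(** Oracle computability, by Kleene's schemes for unary partial functions on
    [nat]; several arguments are packed with the Cantor pairing. A partial
    function is represented by its graph. *)

Definition pairn (x y : nat) : nat := Cantor.to_nat (x, y).

Inductive code : Type :=
| CZero
| CSucc
| CFst
| CSnd
| COracle
| CPair of code & code
| CComp of code & code
| CPrec of code & code
| CMu of code.

Definition pfun := nat -> nat -> Prop.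

(* h(a, 0) = f(a) and h(a, n+1) = g(a, (n, h(a, n))) *)
Fixpoint prec_graph (f g : pfun) (a n y : nat) : Prop :=
  if n is m.+1 then
    exists z, prec_graph f g a m z /\ g (pairn a (pairn m z)) y
  else f a y.

(* the least y with f(x, y) = 0, all earlier values being defined *)
Definition mu_graph (f : pfun) : pfun := fun x y =>
  f (pairn x y) 0%N /\
  forall m : nat, (m < y)%N -> exists z : nat, f (pairn x m) z.+1.

Fixpoint eval (A : nat -> bool) (c : code) : pfun :=
  match c with
  | CZero => fun _ y => y = 0%N
  | CSucc => fun x y => y = x.+1
  | CFst => fun x y => y = (Cantor.of_nat x).1
  | CSnd => fun x y => y = (Cantor.of_nat x).2
  | COracle => fun x y => y = nat_of_bool (A x)
  | CPair c1 c2 => fun x y =>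
      exists y1 y2, [/\ eval A c1 x y1, eval A c2 x y2 & y = pairn y1 y2]
  | CComp c1 c2 => fun x y => exists z, eval A c2 x z /\ eval A c1 z y
  | CPrec c1 c2 => fun x y =>
      prec_graph (eval A c1) (eval A c2)
        (Cantor.of_nat x).1 (Cantor.of_nat x).2 y
  | CMu c1 => mu_graph (eval A c1)
  end.

Definition halts (A : nat -> bool) (c : code) (x : nat) : Prop :=
  exists y, eval A c x y.

Lemma eval_functional (A : nat -> bool) (c : code) (x y y' : nat) :
  eval A c x y -> eval A c x y' -> y = y'.
Proof.
elim: c x y y' => /=; try by move=> x y y' -> ->.
- move=> c1 IH1 c2 IH2 x y y' [a [b [h1 h2 ->]]] [a' [b' [h1' h2' ->]]].
  by rewrite (IH1 _ _ _ h1 h1') (IH2 _ _ _ h2 h2').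
- move=> c1 IH1 c2 IH2 x y y' [a [h2 h1]] [a' [h2' h1']].
  by rewrite (IH2 _ _ _ h2 h2') in h1; exact: IH1 h1 h1'.
- move=> c1 IH1 c2 IH2 x; case: (Cantor.of_nat x) => a n /=.
  elim: n => [|n IHn] y y' /=; first exact: IH1.
  move=> [z [hz hy]] [z' [hz' hy']].
  by rewrite (IHn _ _ hz hz') in hy; exact: IH2 hy hy'.
- move=> c IH x y y' [hy ly] [hy' ly']; case: (ltngtP y y') => // h.
    by have [z /IH /(_ hy)] := ly' _ h.
  by have [z /IH /(_ hy')] := ly _ h.
Qed.

Definition turing_le (g : nat -> nat) (A : nat -> bool) : Prop :=
  exists c, forall n, eval A c n (g n).

Fixpoint code_num (c : code) : nat :=
  match c with
  | CZero => pairn 0 0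
  | CSucc => pairn 1 0
  | CFst => pairn 2 0
  | CSnd => pairn 3 0
  | COracle => pairn 4 0
  | CPair c1 c2 => pairn 5 (pairn (code_num c1) (code_num c2))
  | CComp c1 c2 => pairn 6 (pairn (code_num c1) (code_num c2))
  | CPrec c1 c2 => pairn 7 (pairn (code_num c1) (code_num c2))
  | CMu c1 => pairn 8 (code_num c1)
  end.

Lemma code_num_inj : injective code_num.
Proof.
elim=> [|||||c IHc d IHd|c IHc d IHd|c IHc d IHd|c IHc];
  case=> [|||||c' d'|c' d'|c' d'|c'] //= /Cantor.to_nat_inj [] //.
- by move=> /Cantor.to_nat_inj [] /IHc -> /IHd ->.
- by move=> /Cantor.to_nat_inj [] /IHc -> /IHd ->.
- by move=> /Cantor.to_nat_inj [] /IHc -> /IHd ->.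
- by move=> /IHc ->.
Qed.

Definition jump (A : nat -> bool) : nat -> bool := fun e =>
  `[< exists c, code_num c = e /\ halts A c e >].

Definition zero_jump : nat -> bool := jump (fun=> false).

Definition cylinder (s : seq bool) : set cantor_space :=
  [set X : cantor_space | mkseq X (size s) = s].

Definition measurable_cantor : Type := g_sigma_algebraType (range cylinder).

HB.instance Definition _ := Measurable.on measurable_cantor.

(** The fair-coin measure, as the law of the binary digits of a uniformly
    distributed point of [[0, 1]]. *)

Section fair_coin.
Variable R : realType.

Definition binary_digits (x : measurableTypeR R) : measurable_cantor :=
  fun n : nat => odd (Num.truncn (2 ^+ n.+1 * x)).

Lemma measurable_binary_digits :
  measurable_fun [set: measurableTypeR R] binary_digits.
Proof.
have mT (c : R) (n : nat) :
    measurable [set x : measurableTypeR R | (Num.truncn (c * x) <= n)%N].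
  rewrite (_ : mkset _ = ( *%R c) @^-1` `]-oo, n.+1%:R[); last first.
    by apply/seteqP; split => x /=; rewrite in_itv/= truncn_le_nat.
  rewrite -[X in measurable X]setTI.
  exact: mulrl_measurable.
have mP (c : R) (P : pred nat) :
    measurable [set x : measurableTypeR R | P (Num.truncn (c * x))].
  rewrite (_ : mkset _ = \bigcup_(k in [set k | P k])
      [set x : R | Num.truncn (c * x) = k]); last first.
    apply/seteqP; split => [x /= Px|x [k /= Pk ->//]].
    by exists (Num.truncn (c * x)).
  apply: bigcup_measurable => -[|k] _.
    rewrite (_ : mkset _ = [set x | (Num.truncn (c * x) <= 0)%N]); last first.
      by apply/seteqP; split => x /=; rewrite leqn0 => /eqP.
    exact: mT.
  rewrite (_ : mkset _ = [set x | (Num.truncn (c * x) <= k.+1)%N] `\`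
      [set x | (Num.truncn (c * x) <= k)%N]); last first.
    apply/seteqP; split => x /=; first by move=> ->; rewrite leqnn ltnn.
    by move=> [h /negP]; rewrite -ltnNge => h'; apply/eqP; rewrite eqn_leq h.
  by apply: measurableD; exact: mT.
apply: (@measurability _ _ (measurableTypeR R) measurable_cantor setT binary_digits (range cylinder : set (set measurable_cantor)) erefl).
move=> _ [_ [s _ <-] <-]; rewrite setTI.
elim/last_ind: s => [|s b ih].
  rewrite (_ : _ @^-1` _ = setT); first exact: measurableT.
  by apply/seteqP.
rewrite (_ : _ @^-1` _ = (binary_digits @^-1` cylinder s) `&`
  [set x | odd (Num.truncn (2 ^+ (size s).+1 * x)) == b]); last first.
  apply/seteqP; split => x /=; rewrite /cylinder/= size_rcons mkseqS.
    by move=> /eqP; rewrite eqseq_rcons => /andP[/eqP ? ?].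
  by move=> [hs hb]; apply/eqP; rewrite eqseq_rcons hb hs eqxx.
by apply: measurableI => //; exact: (mP _ (fun k => odd k == b)).
Qed.

HB.instance Definition _ := isMeasurableFun.Build _ _ _ _ binary_digits
  measurable_binary_digits.

Definition fair_coin : probability measurable_cantor R :=
  distribution (uniform_prob (@ltr01 R)) binary_digits.

Lemma fair_coin_cylinder (s : seq bool) :
  fair_coin (cylinder s) = ((2^-1) ^+ size s)%:E.
Proof.
pose k := foldl (fun k (b : bool) => k.*2 + b)%N 0%N s.
have ks : (k < 2 ^ size s)%N.
  rewrite /k; elim/last_ind: (s) => [//|t b ih].
  by rewrite foldl_rcons size_rcons expnS; case: b => /=; lia.
have kE (x : R) : 0 <= x < 1 ->
    (mkseq (binary_digits x) (size s) == s)
    = (Num.truncn (2 ^+ size s * x) == k).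
  move=> /andP[x0 x1]; rewrite /k; elim/last_ind: (s) => [|t b ih].
    by rewrite /= expr0 mul1r truncn_eq// x0 x1.
  rewrite size_rcons mkseqS eqseq_rcons ih foldl_rcons /binary_digits.
  set m := Num.truncn (2 ^+ (size t).+1 * x).
  have -> : Num.truncn (2 ^+ size t * x) = m./2.
    apply/eqP; rewrite truncn_eq ?mulr_ge0// /m.
    have : 0 <= 2 ^+ (size t).+1 * x by rewrite mulr_ge0.
    move=> /truncn_itv; rewrite -/m exprS -mulrA.
    set y := 2 ^+ _ * x => /andP[h1 h2].
    have := odd_double_half m; set j := m./2 => jm.
    have jm1 : j%:R * 2 <= m%:R :> R by rewrite -natrM ler_nat; lia.
    have jm2 : m.+1%:R <= j.+1%:R * 2 :> R by rewrite -natrM ler_nat; lia.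
    by apply/andP; split; lra.
  apply/andP/eqP => [[/eqP <- /eqP <-]|->].
    by rewrite addnC odd_double_half.
  rewrite halfD oddD odd_double oddb addFb doubleK andFb add0n.
  by split=> //; case: (b); rewrite /= ?addn0.
pose I : set R := `[k%:R / 2 ^+ size s, k.+1%:R / 2 ^+ size s[%classic.
have muI : lebesgue_measure I = ((2^-1) ^+ size s)%:E.
  rewrite lebesgue_measure_itv/= lte_fin ltr_pM2r ?invr_gt0 ?exprn_gt0//.
  by rewrite ltr_nat ltnSn -EFinB -mulrBl -natrB// subSnn mul1r exprVn.
have IE (x : R) : I x <-> 0 <= x < 1 /\ cylinder s (binary_digits x).
  have p0 : 0 < 2 ^+ size s :> R by rewrite exprn_gt0.
  have IT : I x <-> 0 <= x /\ Num.truncn (2 ^+ size s * x) == k.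
    rewrite /I/= in_itv/= ler_pdivrMr// ltr_pdivlMr// mulrC.
    split=> [h|[x0]]; last by rewrite truncn_eq ?mulr_ge0// ltW.
    have x0 : 0 <= x.
      by rewrite -(pmulr_rge0 _ p0); case/andP: h => + _; exact: le_trans.
    by rewrite truncn_eq ?mulr_ge0// ltW.
  split=> [Ix|[x01 /eqP]].
    have [x0 tk] := IT.1 Ix.
    have x01 : 0 <= x < 1.
      rewrite x0/= -(ltr_pM2l p0) mulr1.
      move: tk; rewrite truncn_eq ?mulr_ge0 ?(ltW p0)// => /andP[_] /lt_le_trans.
      by apply; rewrite -natrX ler_nat.
    by split=> //; apply/eqP; rewrite kE.
  by rewrite kE// => tk; apply/IT; split=> //; case/andP: x01.
pose B := binary_digits @^-1` cylinder s.
have mB : measurable (B : set (measurableTypeR R)).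
  rewrite -[X in measurable X]setTI; apply: measurable_binary_digits => //.
  by apply: sub_sigma_algebra; exists s.
have mB01 : measurable (B `&` `[0, 1]%classic : set (measurableTypeR R)).
  exact: measurableI.
have mI : measurable (I : set (measurableTypeR R)) by exact: measurable_itv.
rewrite /fair_coin /distribution /pushforward/= -/B /uniform_prob.
rewrite integral_uniform_pdf (eq_integral (cst 1%E)); last first.
  move=> x; rewrite inE => -[_]; rewrite /= in_itv/= /uniform_pdf => ->.
  by rewrite subr0 invr1.
rewrite integral_cst// mul1e.
apply/eqP; rewrite eq_le; apply/andP; split; last first.
  rewrite -muI; apply: le_measure; rewrite ?inE//.
  move=> x /IE[/andP[x0 x1] Bx]; split=> //=.
  by rewrite in_itv/= x0 ltW.
rewrite -muI.
apply: (@le_trans _ _ (lebesgue_measure (I `|` [set 1]))).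
  apply: le_measure; rewrite ?inE//; first exact: measurableU.
  move=> x [Bx]; rewrite /= in_itv/= => /andP[x0].
  rewrite le_eqVlt => /predU1P[->|x1]; first by right.
  by left; apply/IE; rewrite x0 x1.
apply: le_trans (measureU2 _ _ _) _ => //.
by rewrite [X in (_ + X)%E]lebesgue_measure_set1 adde0.
Qed.

End fair_coin.

(** Bijective base 2 numbering of binary strings. *)
Definition string_num (s : seq bool) : nat :=
  foldr (fun (b : bool) n => (n.*2 + b).+1) 0%N s.

(** [U 0, U 1, ...] is a uniform sequence of [Sigma^{0,A}_1] classes: [U n] is
    the union of the cylinders over the [n]-th section of an [A]-c.e. set. *)
Definition uniform_Sigma01 (A : nat -> bool) (U : nat -> set cantor_space) :
    Prop :=
  exists c, forall n,
    U n = \bigcup_(s in [set s | halts A c (pairn n (string_num s))])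
            cylinder s.

Definition martin_lof_test (R : realType) (A : nat -> bool)
    (U : nat -> set cantor_space) : Prop :=
  uniform_Sigma01 A U /\
  forall n, (fair_coin R (U n) <= ((2^-1) ^+ n)%:E)%E.

Definition two_random (R : realType) (X : cantor_space) : Prop :=
  forall U, martin_lof_test R zero_jump U -> ~ (\bigcap_n U n) X.

Definition fun_dominates (f g : nat -> nat) : Prop :=
  exists m, forall n, (m < n)%N -> (g n < f n)%N.

Definition ae_dominating (R : realType) (A : cantor_space) : Prop :=
  {ae fair_coin R, forall X : cantor_space,
    forall g, turing_le g X -> exists f, turing_le f A /\ fun_dominates f g}.

(* Main.v *)
Require Import Defs.
From mathcomp Require Import all_boot all_order all_algebra.
From mathcomp Require Import all_classical all_reals all_analysis.
From mathcomp Require Import zify lra.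
(* MathComp-Analysis shadows [eval]. *)
Import Defs.

(** Fix a level [k], with [2 ^ width k] candidates and [reps k] disjoint blocks
    of [width k] bits. Candidates are tried one after the other; the current
    one is dropped at stage [s] when, for some program [c < k], more than a
    fraction [2 ^- k] of the oracles [A] threaten it: the value of [c] with
    oracle [A] at [<k, b>], where [b] is the stage at which the candidate came
    up, is known and at most [s]. An oracle may threaten only [cap k] candidates
    per program, so by counting some candidate stays forever.

    Let [Phi X <k, b>] be the first stage after [b] at which the current
    candidate is not a block of [X]. It is total whenever the final candidate of
    each level is not a block of [X], which has probability at least 1/2. If
    the function [f] computed from [G] by [c] dominates [Phi X], then no
    candidate dropped while [G] was threatening it is a block of [X] at large
    levels.

    The oracles that threaten the final candidate of level [k] form a class of
    measure at most [2 ^- k], and [0'] recognizes the final candidate: this is a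
    Martin-Loef test relative to [0']. If [G] is 2-random it escapes the test,
    which at infinitely many levels is only possible because [G] has used up its
    [cap k] threats. Missing that many candidates with all blocks has
    probability at most [2 ^- k], so the set of [X] whose [Phi X] is dominated
    by a [G]-computable function is null. *)

Set Implicit Arguments.
Unset Strict Implicit.
Unset Printing Implicit Defensive.

(** * Total functions computable uniformly in the oracle *)

Definition fstn (x : nat) : nat := (Cantor.of_nat x).1.
Definition sndn (x : nat) : nat := (Cantor.of_nat x).2.

Lemma fstn_pair x y : fstn (pairn x y) = x.
Proof. by rewrite /fstn /pairn Cantor.cancel_of_to. Qed.

Lemma sndn_pair x y : sndn (pairn x y) = y.
Proof. by rewrite /sndn /pairn Cantor.cancel_of_to. Qed.

Lemma pairn_eta x : pairn (fstn x) (sndn x) = x.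
Proof.
by rewrite /pairn /fstn /sndn -surjective_pairing Cantor.cancel_to_of.
Qed.

Definition pairnE := (fstn_pair, sndn_pair).

Lemma leq_pairn x y : x <= pairn x y.
Proof. have := Cantor.to_nat_non_decreasing x y; rewrite /pairn; lia. Qed.

(** One code serves every oracle. Boolean tests enter through the coercion of [bool] to [nat]. *)
Definition recf (F : (nat -> bool) -> nat -> nat) : Prop :=
  exists c, forall A x, eval A c x (F A x).

Lemma eq_recf F G : (forall A x, F A x = G A x) -> recf F -> recf G.
Proof. by move=> FG [c cP]; exists c => A x; rewrite -FG. Qed.

Lemma recf_comp F G : recf F -> recf G -> recf (fun A x => F A (G A x)).
Proof.
by move=> [c cP] [d dP]; exists (CComp c d) => A x /=; exists (G A x).
Qed.

Lemma recf_pair F G : recf F -> recf G -> recf (fun A x => pairn (F A x) (G A x)).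
Proof.
move=> [c cP] [d dP]; exists (CPair c d) => A x /=.
by exists (F A x), (G A x).
Qed.

Lemma recf_fst F : recf F -> recf (fun A x => fstn (F A x)).
Proof. by apply: (@recf_comp (fun=> fstn)); exists CFst. Qed.

Lemma recf_snd F : recf F -> recf (fun A x => sndn (F A x)).
Proof. by apply: (@recf_comp (fun=> sndn)); exists CSnd. Qed.

Lemma recf_id : recf (fun _ x => x).
Proof.
exists (CPair CFst CSnd) => A x /=.
by exists (fstn x), (sndn x); rewrite pairn_eta.
Qed.

Lemma recf_succ F : recf F -> recf (fun A x => (F A x).+1).
Proof. by apply: (@recf_comp (fun=> succn)); exists CSucc. Qed.

Lemma recf_cst n : recf (fun _ _ => n).
Proof. by elim: n => [|n ih]; [exists CZero | exact: recf_succ]. Qed.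

Lemma recf_oracle F : recf F -> recf (fun A x => A (F A x)).
Proof. by apply: (@recf_comp (fun A x => A x)); exists COracle. Qed.

(** The step reads the packed argument that [CPrec] hands to its second program: parameter, then
    counter, then the value so far. *)
Lemma recf_iteri (N F : (nat -> bool) -> nat -> nat) G :
  recf N -> recf F ->
  recf (fun A p => G A (fstn p) (fstn (sndn p)) (sndn (sndn p))) ->
  recf (fun A x => iteri (N A x) (G A x) (F A x)).
Proof.
move=> rN [f fP] [g gP].
have rP : recf (fun A p => iteri (sndn p) (G A (fstn p)) (F A (fstn p))).
  exists (CPrec f g) => A p /=; rewrite -/(fstn p) -/(sndn p).
  elim: (sndn p) => [|m ih]; first exact: fP.
  exists (iteri m (G A (fstn p)) (F A (fstn p))); split=> //=.
  by have := gP A (pairn (fstn p) (pairn m (iteri m (G A (fstn p)) (F A (fstn p)))));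
    rewrite !pairnE.
apply: eq_recf (recf_comp rP (recf_pair recf_id rN)).
by move=> A x; rewrite !pairnE.
Qed.

Lemma recf_iter (N F : (nat -> bool) -> nat -> nat) G :
  recf N -> recf F -> recf (fun A p => G A (fstn p) (sndn p)) ->
  recf (fun A x => iter (N A x) (G A x) (F A x)).
Proof.
move=> rN rF rG.
apply: (@eq_recf (fun A x => iteri (N A x) (fun=> G A x) (F A x))).
  by move=> A x; elim: (N A x) => //= n ->.
apply: recf_iteri => //.
apply: eq_recf (recf_comp rG (recf_pair (recf_fst recf_id)
  (recf_snd (recf_snd recf_id)))).
by move=> A x; rewrite !pairnE.
Qed.

Lemma recf_pred F : recf F -> recf (fun A x => (F A x).-1).
Proof.
move=> rF; apply: (@eq_recf (fun A x => iteri (F A x) (fun m _ => m) 0)).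
  by move=> A x; case: (F A x).
apply: recf_iteri => //; first exact: recf_cst.
exact: recf_fst (recf_snd recf_id).
Qed.

Lemma recf_add F G : recf F -> recf G -> recf (fun A x => F A x + G A x).
Proof.
move=> rF rG; apply: (@eq_recf (fun A x => iter (G A x) succn (F A x))).
  by move=> A x; elim: (G A x) => [|n /= ->]; rewrite ?addn0 ?addnS.
apply: recf_iter => //; exact: recf_succ (recf_snd recf_id).
Qed.

Lemma recf_sub F G : recf F -> recf G -> recf (fun A x => F A x - G A x).
Proof.
move=> rF rG; apply: (@eq_recf (fun A x => iter (G A x) predn (F A x))).
  by move=> A x; elim: (G A x) => [|n /= ->]; rewrite ?subn0 ?subnS.
apply: recf_iter => //; exact: recf_pred (recf_snd recf_id).
Qed.

Lemma recf_mul F G : recf F -> recf G -> recf (fun A x => F A x * G A x).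
Proof.
move=> rF rG; apply: (@eq_recf (fun A x => iter (G A x) (addn (F A x)) 0)).
  by move=> A x; elim: (G A x) => [|n /= ->]; rewrite ?muln0 ?mulnS.
apply: recf_iter => //; first exact: recf_cst.
apply: recf_add; last exact: recf_snd recf_id.
exact: (recf_comp rF (recf_fst recf_id)).
Qed.

Lemma recf_expn b F : recf F -> recf (fun A x => b ^ F A x).
Proof.
move=> rF; apply: (@eq_recf (fun A x => iter (F A x) (muln b) 1)).
  by move=> A x; elim: (F A x) => [|n /= ->]; rewrite ?expnS.
apply: recf_iter => //; first exact: recf_cst.
by apply: recf_mul; [exact: recf_cst | exact: recf_snd recf_id].
Qed.

Lemma recf_leq F G : recf F -> recf G -> recf (fun A x => F A x <= G A x : nat).
Proof.
move=> rF rG; apply: eq_recf (recf_sub (recf_cst 1) (recf_sub rF rG)).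
by move=> A x; lia.
Qed.

Lemma recf_and (P Q : (nat -> bool) -> nat -> bool) :
  recf P -> recf Q -> recf (fun A x => P A x && Q A x).
Proof.
move=> rP rQ; apply: eq_recf (recf_mul rP rQ).
by move=> A x; case: (P A x); case: (Q A x).
Qed.

Lemma recf_not (P : (nat -> bool) -> nat -> bool) :
  recf P -> recf (fun A x => ~~ P A x).
Proof.
move=> rP; apply: eq_recf (recf_sub (recf_cst 1) rP).
by move=> A x; case: (P A x).
Qed.

Lemma recf_eq F G : recf F -> recf G -> recf (fun A x => F A x == G A x).
Proof.
move=> rF rG; apply: eq_recf (recf_and (recf_leq rF rG) (recf_leq rG rF)).
by move=> A x; rewrite eqn_leq.
Qed.

Lemma recf_eqb (P Q : (nat -> bool) -> nat -> bool) :
  recf P -> recf Q -> recf (fun A x => P A x == Q A x).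
Proof.
move=> rP rQ; apply: eq_recf (recf_eq rP rQ).
by move=> A x; case: (P A x); case: (Q A x).
Qed.

Lemma recf_if (P : (nat -> bool) -> nat -> bool) F G :
  recf P -> recf F -> recf G -> recf (fun A x => if P A x then F A x else G A x).
Proof.
move=> rP rF rG.
apply: eq_recf (recf_add (recf_mul rP rF) (recf_mul (recf_not rP) rG)).
by move=> A x; case: (P A x); lia.
Qed.

Lemma recf_count (N : (nat -> bool) -> nat -> nat) (P : _ -> _ -> nat -> bool) :
  recf N -> recf (fun A p => P A (fstn p) (sndn p)) ->
  recf (fun A x => count (P A x) (iota 0 (N A x))).
Proof.
move=> rN rP.
apply: (@eq_recf (fun A x => iteri (N A x) (fun m z => z + P A x m) 0)).
  move=> A x; elim: (N A x) => [//|n /= ->].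
  by rewrite -[_ + count _ _]/(count _ (iota 0 n.+1)) -addn1 iotaD count_cat /= addn0.
apply: recf_iteri => //; first exact: recf_cst.
apply: recf_add; first exact: recf_snd (recf_snd recf_id).
apply: eq_recf (recf_comp rP (recf_pair (recf_fst recf_id)
  (recf_fst (recf_snd recf_id)))).
by move=> A x; rewrite !pairnE.
Qed.

Lemma recf_has (N : (nat -> bool) -> nat -> nat) (P : _ -> _ -> nat -> bool) :
  recf N -> recf (fun A p => P A (fstn p) (sndn p)) ->
  recf (fun A x => has (P A x) (iota 0 (N A x))).
Proof.
move=> rN rP; apply: eq_recf (recf_leq (recf_cst 1) (recf_count rN rP)).
by move=> A x; rewrite has_count.
Qed.

Lemma recf_all (N : (nat -> bool) -> nat -> nat) (P : _ -> _ -> nat -> bool) :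
  recf N -> recf (fun A p => P A (fstn p) (sndn p)) ->
  recf (fun A x => all (P A x) (iota 0 (N A x))).
Proof.
move=> rN rP.
apply: eq_recf (recf_not (recf_has (P := fun A x i => ~~ P A x i) rN _)).
  by move=> A x; rewrite has_predC negbK.
exact: recf_not.
Qed.

(** The quotient counts the positive multiples of the divisor up to the dividend, so bounded
    counting computes it. *)
Lemma recf_divX F G : recf F -> recf G -> recf (fun A x => F A x %/ 2 ^ G A x).
Proof.
move=> rF rG.
apply: (@eq_recf (fun A x =>
  count (fun i => i.+1 * 2 ^ G A x <= F A x) (iota 0 (F A x)))).
  move=> A x; set m := F A x; set d := 2 ^ _.
  have d0 : 0 < d by rewrite expn_gt0.
  have E i : (i.+1 * d <= m) = (i < m %/ d) by rewrite leq_divRL.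
  rewrite (eq_count E).
  have : m %/ d <= m by exact: leq_div.
  move: (m %/ d) => q /subnKC <-; rewrite iotaD count_cat.
  rewrite (eq_in_count (a2 := predT)); last by move=> i; rewrite mem_iota.
  rewrite (eq_in_count (s := iota _ (m - q)) (a2 := pred0)); last first.
    by move=> i; rewrite mem_iota /= => /andP[qi _]; apply/negbTE; rewrite -leqNgt.
  by rewrite count_predT count_pred0 size_iota addn0.
apply: recf_count => //; apply: recf_leq.
  apply: recf_mul; first exact: recf_succ (recf_snd recf_id).
  exact: recf_expn (recf_comp rG (recf_fst recf_id)).
exact: recf_comp rF (recf_fst recf_id).
Qed.

Lemma recf_odd F : recf F -> recf (fun A x => odd (F A x)).
Proof.
move=> rF; apply: eq_recf (recf_not (recf_eq (recf_mul (recf_cst 2)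
  (recf_divX rF (recf_cst 1))) rF)).
move=> A x; rewrite divn2; have := odd_double_half (F A x).
by case: odd => /=; lia.
Qed.

Definition bitn (w i : nat) : bool := odd (w %/ 2 ^ i).

Lemma recf_bitn F G : recf F -> recf G -> recf (fun A x => bitn (F A x) (G A x)).
Proof. by move=> rF rG; apply: recf_odd; exact: recf_divX. Qed.

(** The patterns [@?f A x] abstract oracle and input out of the subterms, so that the outermost
    operation selects the closure lemma. *)
Ltac recf1 := match goal with
  | |- recf (fun A x => x) => exact: recf_id
  | |- recf (fun A x => ?n) => exact: recf_cst
  | |- recf (fun A x => nat_of_bool (A (@?f A x))) => apply: (@recf_oracle f)
  | |- recf (fun A x => pairn (@?f A x) (@?g A x)) => apply: (@recf_pair f g)
  | |- recf (fun A x => fstn (@?f A x)) => apply: (@recf_fst f)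
  | |- recf (fun A x => sndn (@?f A x)) => apply: (@recf_snd f)
  | |- recf (fun A x => (@?f A x).+1) => apply: (@recf_succ f)
  | |- recf (fun A x => (@?f A x).-1) => apply: (@recf_pred f)
  | |- recf (fun A x => @?f A x + @?g A x) => apply: (@recf_add f g)
  | |- recf (fun A x => @?f A x - @?g A x) => apply: (@recf_sub f g)
  | |- recf (fun A x => @?f A x * @?g A x) => apply: (@recf_mul f g)
  | |- recf (fun A x => ?b ^ @?f A x) => apply: (@recf_expn b f)
  | |- recf (fun A x => nat_of_bool (@?f A x && @?g A x)) =>
         apply: (@recf_and f g)
  | |- recf (fun A x => nat_of_bool (~~ @?f A x)) => apply: (@recf_not f)
  | |- recf (fun A x => nat_of_bool (@?f A x <= @?g A x)) =>
         apply: (@recf_leq f g)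
  | |- recf (fun A x => nat_of_bool (@eq_op _ (@?f A x) (@?g A x))) =>
         first [apply: (@recf_eq f g) | apply: (@recf_eqb f g)]
  | |- recf (fun A x => nat_of_bool (bitn (@?f A x) (@?g A x))) =>
         apply: (@recf_bitn f g)
  | |- recf (fun A x => nat_of_bool (has (@?p A x) (iota 0 (@?n A x)))) =>
         apply: (@recf_has n p)
  | |- recf (fun A x => nat_of_bool (all (@?p A x) (iota 0 (@?n A x)))) =>
         apply: (@recf_all n p)
  | |- recf (fun A x => count (@?p A x) (iota 0 (@?n A x))) =>
         apply: (@recf_count n p)
  | |- recf (fun A x => iter (@?n A x) (@?g A x) (@?f A x)) =>
         apply: (@recf_iter n f g)
  | H : recf ?f |- recf ?f => exact: H
  | H : recf ?f |- recf (fun A x => ?f A (@?g A x)) => apply: (@recf_comp f g)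
  | |- recf (fun A x => if _ then _ else _) => apply: recf_if
  end.
Ltac recf := repeat (recf1; cbv beta zeta).

(** [CMu] looks for the value 0, so it is applied to the negation of [P]. As that function is total,
    the search meets the least solution whenever there is one. *)
Lemma recf_mu (P : (nat -> bool) -> nat -> nat -> bool) :
  recf (fun A p => P A (fstn p) (sndn p)) ->
  exists c, forall A x y, eval A c x y <-> P A x y /\ forall m, m < y -> ~~ P A x m.
Proof.
move=> /recf_not [c cP]; exists (CMu c) => A x y /=; rewrite /mu_graph.
have E z b : eval A c (pairn x z) b <-> b = ~~ P A x z.
  have := cP A (pairn x z); rewrite !pairnE => h.
  by split=> [/(eval_functional h)|->].
split=> [[/E Py lty]|[Py lty]]; split.
- by case: (P A x y) Py.
- by move=> m /lty [z /E]; case: (P A x m).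
- by apply/E; rewrite Py.
- by move=> m /lty Pm; exists 0; apply/E; rewrite Pm.
Qed.

(* Otherwise unification may evaluate pairings of numerals. *)
Opaque pairn fstn sndn.

(** * An abstract machine for oracle programs *)

Definition cfg_eval (c x K : nat) : nat := pairn 0 (pairn K (pairn c x)).
Definition cfg_ret (y K : nat) : nat := pairn 1 (pairn K y).
Definition cfg_stuck : nat := pairn 2 0.
(** The successor keeps nonempty stacks apart from the empty stack [0]. Frame tags: 0 and 4 await
    the first and second component of a pair, 1 the inner value of a composition, 2 a value in a
    primitive recursion, 3 a test of a minimization. *)
Definition push (f K : nat) : nat := (pairn f K).+1.

(* [cfg_eval c x K] is about to run program [c] on [x], [cfg_ret y K] returns
   [y] to the stack of frames [K]. A query at [s] or above gets stuck, so that a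
   terminating run only depends on the oracle below [s]. *)
Definition step (a : nat -> bool) (s C : nat) : nat :=
  let K := fstn (sndn C) in let d := sndn (sndn C) in
  if fstn C == 0 then
    let c := sndn (fstn d) in let x := sndn d in let tag := fstn (fstn d) in
    if tag == 0 then cfg_ret 0 K
    else if tag == 1 then cfg_ret x.+1 K
    else if tag == 2 then cfg_ret (fstn x) K
    else if tag == 3 then cfg_ret (sndn x) K
    else if tag == 4 then if x < s then cfg_ret (a x) K else cfg_stuck
    else if tag == 5 then
      cfg_eval (fstn c) x (push (pairn 0 (pairn (sndn c) x)) K)
    else if tag == 6 then cfg_eval (sndn c) x (push (pairn 1 (fstn c)) K)
    else if tag == 7 then
      cfg_eval (fstn c) (fstn x)
        (push (pairn 2 (pairn (sndn c) (pairn (fstn x) (pairn 0 (sndn x))))) K)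
    else cfg_eval c (pairn x 0) (push (pairn 3 (pairn c (pairn x 0))) K)
  else if fstn C == 1 then
    if K == 0 then C else
    let f := fstn K.-1 in let L := sndn K.-1 in let e := sndn f in
    if fstn f == 0 then cfg_eval (fstn e) (sndn e) (push (pairn 4 d) L)
    else if fstn f == 1 then cfg_eval e d L
    else if fstn f == 2 then
      let x := fstn (sndn e) in
      let m := fstn (sndn (sndn e)) in let n := sndn (sndn (sndn e)) in
      if m == n then cfg_ret d L
      else cfg_eval (fstn e) (pairn x (pairn m d))
             (push (pairn 2 (pairn (fstn e) (pairn x (pairn m.+1 n)))) L)
    else if fstn f == 3 then
      let x := fstn (sndn e) in let m := sndn (sndn e) in
      if d == 0 then cfg_ret m L
      else cfg_eval (fstn e) (pairn x m.+1)
             (push (pairn 3 (pairn (fstn e) (pairn x m.+1))) L)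
    else cfg_ret (pairn e d) L
  else C.

Lemma recf_step W S C :
  recf W -> recf S -> recf C -> recf (fun A x => step (bitn (W A x)) (S A x) (C A x)).
Proof.
move=> rW rS rC; rewrite /step /cfg_ret /cfg_eval /cfg_stuck /push.
recf.
Qed.

Section run.
Variable A : nat -> bool.

(** The use principle is built in: the same number of steps works for every oracle that agrees with
    [A] far enough. *)
Definition run (C C' : nat) : Prop :=
  exists t u, forall a s, u <= s -> (forall i, i < s -> a i = A i) ->
    iter t (step a s) C = C'.

Lemma run_trans C1 C2 C3 : run C1 C2 -> run C2 C3 -> run C1 C3.
Proof.
move=> [t [u h]] [t' [u' h']]; exists (t' + t), (u + u') => a s us aA.
by rewrite iterD h ?h' //; lia.
Qed.

Lemma run_step C1 C2 :
  (forall a s, step a s C1 = C2) -> run C1 C2.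
Proof. by move=> h; exists 1, 0 => a s _ _ /=. Qed.

(** Induction on the program with the stack free, as subprograms run under further frames. Primitive
    recursion and minimization need an inner induction along their loops. *)
Lemma run_eval c x y K :
  eval A c x y -> run (cfg_eval (code_num c) x K) (cfg_ret y K).
Proof.
elim: c x y K => [|||||c1 IH1 c2 IH2|c1 IH1 c2 IH2|c1 IH1 c2 IH2|c1 IH1] x y K.
- by move=> ->; apply: run_step => a s; rewrite /step /cfg_eval /= !pairnE.
- by move=> ->; apply: run_step => a s; rewrite /step /cfg_eval /= !pairnE.
- by move=> ->; apply: run_step => a s; rewrite /step /cfg_eval /= !pairnE.
- by move=> ->; apply: run_step => a s; rewrite /step /cfg_eval /= !pairnE.
- move=> ->; exists 1, x.+1 => a s xs aA.
  by rewrite /step /cfg_eval /= !pairnE /= xs aA.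
- move=> [y1 [y2 [h1 h2 ->]]].
  apply: (run_trans (C2 := cfg_eval (code_num c1) x
    (push (pairn 0 (pairn (code_num c2) x)) K))).
    by apply: run_step => a s; rewrite /step /cfg_eval /= !pairnE.
  apply: run_trans (IH1 _ _ _ h1) _.
  apply: (run_trans (C2 := cfg_eval (code_num c2) x (push (pairn 4 y1) K))).
    by apply: run_step => a s; rewrite /step /cfg_ret /push /= !pairnE.
  apply: run_trans (IH2 _ _ _ h2) _.
  by apply: run_step => a s; rewrite /step /cfg_ret /push /= !pairnE.
- move=> [z [h2 h1]].
  apply: (run_trans (C2 := cfg_eval (code_num c2) x
    (push (pairn 1 (code_num c1)) K))).
    by apply: run_step => a s; rewrite /step /cfg_eval /= !pairnE.
  apply: run_trans (IH2 _ _ _ h2) _.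
  apply: run_trans (IH1 _ _ _ h1).
  by apply: run_step => a s; rewrite /step /cfg_ret /push /= !pairnE.
- move=> /=; rewrite -/(fstn x) -/(sndn x).
  (* The counter [m] in a frame is the index of the awaited value, so the loop ends when it reaches
     [sndn x]. *)
  set frame := fun m => push (pairn 2 (pairn (code_num c2)
    (pairn (fstn x) (pairn m (sndn x))))) K.
  have H m z : m <= sndn x ->
      prec_graph (eval A c1) (eval A c2) (fstn x) m z ->
      run (cfg_eval (pairn 7 (pairn (code_num c1) (code_num c2))) x K)
        (cfg_ret z (frame m)).
    elim: m z => [|m ih] z mx /=.
      move=> h1; apply: run_trans (IH1 _ _ _ h1).
      by apply: run_step => a s; rewrite /step /cfg_eval /= !pairnE.
    move=> [w [/(ih _ (ltnW mx)) hw h2]].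
    apply: run_trans hw _; apply: run_trans (IH2 _ _ _ h2).
    apply: run_step => a s; rewrite /step /cfg_ret /push /= !pairnE /=.
    by rewrite ltn_eqF.
  move=> /(H _ _ (leqnn _)) h; apply: run_trans h _.
  by apply: run_step => a s; rewrite /step /cfg_ret /push /= !pairnE /= eqxx.
- move=> [hy hlt].
  set frame := fun m => push (pairn 3 (pairn (code_num c1) (pairn x m))) K.
  have H m : m <= y ->
      run (cfg_eval (pairn 8 (code_num c1)) x K)
        (cfg_eval (code_num c1) (pairn x m) (frame m)).
    elim: m => [|m ih] my.
      by apply: run_step => a s; rewrite /step /cfg_eval /= !pairnE.
    apply: run_trans (ih (ltnW my)) _.
    have [z hz] := hlt _ my; apply: run_trans (IH1 _ _ _ hz) _.
    by apply: run_step => a s; rewrite /step /cfg_ret /push /= !pairnE.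
  apply: run_trans (H _ (leqnn _)) _; apply: run_trans (IH1 _ _ _ hy) _.
  by apply: run_step => a s; rewrite /step /cfg_ret /push /= !pairnE.
Qed.

End run.

(** The stage [s] bounds the running time, the oracle queries and also the output. The bound on the
    output lets a halting stage stand in for the computed value. *)
Definition halts_in (a : nat -> bool) (s c x : nat) : bool :=
  let C := iter s (step a s) (cfg_eval c x 0) in
  (C == cfg_ret (sndn (sndn C)) 0) && (sndn (sndn C) <= s).

Lemma recf_halts_in W S C X : recf W -> recf S -> recf C -> recf X ->
  recf (fun A x => halts_in (bitn (W A x)) (S A x) (C A x) (X A x)).
Proof.
move=> rW rS rC rX; pose I A x :=
  iter (S A x) (step (bitn (W A x)) (S A x)) (cfg_eval (C A x) (X A x) 0).
have rI : recf I.
  apply: recf_iter => //; first by rewrite /cfg_eval; recf.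
  by apply: recf_step; recf.
apply: (@eq_recf (fun A x => (I A x == cfg_ret (sndn (sndn (I A x))) 0) &&
  (sndn (sndn (I A x)) <= S A x))) => //.
by clearbody I; rewrite /cfg_ret; recf.
Qed.

Lemma halts_inP a s c x : reflect
  (exists2 y, iter s (step a s) (cfg_eval c x 0) = cfg_ret y 0 & y <= s)
  (halts_in a s c x).
Proof.
apply: (iffP andP) => [[/eqP E ys]|[y -> ys]].
  by exists (sndn (sndn (iter s (step a s) (cfg_eval c x 0)))).
by rewrite /cfg_ret !pairnE eqxx.
Qed.

Lemma step_ret a s y : step a s (cfg_ret y 0) = cfg_ret y 0.
Proof. by rewrite /step /cfg_ret !pairnE. Qed.

Lemma step_stuck a s : step a s cfg_stuck = cfg_stuck.
Proof. by rewrite /step /cfg_stuck !pairnE. Qed.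

Lemma ret_neq_stuck y K : cfg_ret y K <> cfg_stuck.
Proof. by move=> /(congr1 fstn); rewrite !pairnE. Qed.

Lemma iter_fix (f : nat -> nat) z n : f z = z -> iter n f z = z.
Proof. by move=> fz; elim: n => //= n ->. Qed.

Lemma iter_step_ret a s c x y t t' : t <= t' ->
  iter t (step a s) (cfg_eval c x 0) = cfg_ret y 0 ->
  iter t' (step a s) (cfg_eval c x 0) = cfg_ret y 0.
Proof.
by move=> /subnK <- h; rewrite iterD h iter_fix // step_ret.
Qed.

(** Only an oracle query looks at [a] or [s], and a query at [s] or above gets stuck. *)
Lemma step_grow a a' s s' C : s <= s' -> (forall i, i < s -> a i = a' i) ->
  step a s C = cfg_stuck \/ step a s C = step a' s' C.
Proof.
move=> ss aa; rewrite /step; set x := sndn (sndn (sndn C)).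
have [xs|xs] := ltnP x s; first by rewrite aa // (leq_trans xs ss); right.
case: (fstn C == 0); last by right.
case: (fstn (fstn (sndn (sndn C))) == 0); first by right.
case: (fstn (fstn (sndn (sndn C))) == 1); first by right.
case: (fstn (fstn (sndn (sndn C))) == 2); first by right.
case: (fstn (fstn (sndn (sndn C))) == 3); first by right.
case: (fstn (fstn (sndn (sndn C))) == 4); first by left.
by right.
Qed.

(** A stuck run stays stuck, so a run that returns never got stuck and is copied step by step under
    the longer oracle. *)
Lemma iter_step_grow a a' s s' c x y t : s <= s' ->
  (forall i, i < s -> a i = a' i) ->
  iter t (step a s) (cfg_eval c x 0) = cfg_ret y 0 ->
  iter t (step a' s') (cfg_eval c x 0) = cfg_ret y 0.
Proof.
move=> ss aa hy; rewrite -hy; move: hy.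
suff : iter t (step a s) (cfg_eval c x 0) = cfg_stuck \/
    iter t (step a s) (cfg_eval c x 0) = iter t (step a' s') (cfg_eval c x 0).
  by case=> [-> /esym /ret_neq_stuck|->].
elim: t => [|t] /=; [by right | case=> [->|ih]].
  by left; exact: step_stuck.
by rewrite -ih; exact: step_grow.
Qed.

Lemma halts_in_grow a a' s s' c x : s <= s' -> (forall i, i < s -> a i = a' i) ->
  halts_in a s c x -> halts_in a' s' c x.
Proof.
move=> ss aa /halts_inP [y hy ys]; apply/halts_inP; exists y; last exact: leq_trans ss.
exact: iter_step_ret ss (iter_step_grow ss aa hy).
Qed.

Lemma eq_halts_in a a' s c x : (forall i, i < s -> a i = a' i) ->
  halts_in a s c x = halts_in a' s c x.
Proof.
move=> aa; apply/idP/idP; apply: halts_in_grow => //.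
by move=> i /aa.
Qed.

(** For the second half, the halting run and the run of [run_eval] are both prolonged to a common
    query bound and a common time, where their outputs must agree. *)
Lemma halts_in_eval A c x y : eval A c x y ->
  (exists s, halts_in A s (code_num c) x) /\
  (forall s, halts_in A s (code_num c) x -> y <= s).
Proof.
move=> /(run_eval 0) [t [u h]]; split.
  exists (t + u + y); apply/halts_inP; exists y; last by lia.
  apply: (@iter_step_ret _ _ _ _ _ t); first by lia.
  by apply: h => //; lia.
move=> s /halts_inP [z hz zs].
have := iter_step_grow (leq_maxl s u) (fun _ _ => erefl) hz.
move=> /(iter_step_ret (leq_maxl s t)).
have := h A _ (leq_maxr s u) (fun _ _ => erefl).
move=> /(iter_step_ret (leq_maxr s t)) -> /(congr1 sndn).
by rewrite /cfg_ret !pairnE => /(congr1 sndn); rewrite !pairnE => ->.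
Qed.

(** * Candidates and threats *)

Lemma countE (T : Type) (p : pred T) (s : seq T) :
  count p s = \sum_(i <- s) p i.
Proof. by elim: s => [|x s ih]; rewrite ?big_nil // big_cons /= ih. Qed.

Lemma leq_sum_size (T : Type) (r : seq T) (F : T -> nat) m :
  (forall i, F i <= m) -> \sum_(i <- r) F i <= size r * m.
Proof.
by move=> Fm; elim: r => [|x r ih]; rewrite ?big_nil // big_cons mulSn leq_add.
Qed.

Lemma bitn_addX m w i : i < m -> bitn (2 ^ m + w) i = bitn w i.
Proof.
move=> im; rewrite /bitn divnDl; last by rewrite dvdn_exp2l // ltnW.
rewrite -expnB ?(ltnW im) // oddD oddX /=.
by rewrite subn_eq0 leqNgt im.
Qed.

(** Each further bit doubles the count, because adding a higher power of 2 leaves the bits below [n]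
    alone. *)
Lemma count_scale (P : pred nat) n d :
  (forall w w', (forall i, i < n -> bitn w i = bitn w' i) -> P w = P w') ->
  count P (iota 0 (2 ^ (n + d))) = 2 ^ d * count P (iota 0 (2 ^ n)).
Proof.
move=> hP; elim: d => [|d ih]; first by rewrite addn0 mul1n.
rewrite addnS expnS mul2n -addnn iotaD count_cat ih add0n.
have -> : iota (2 ^ (n + d)) (2 ^ (n + d)) =
    map (addn (2 ^ (n + d))) (iota 0 (2 ^ (n + d))) by rewrite -iotaDl addn0.
rewrite count_map (eq_count (a2 := P)) ?ih; first by rewrite expnS; lia.
by move=> w /=; apply: hP => i i_n; apply: bitn_addX; rewrite ltn_addr.
Qed.

Fixpoint numb (a : nat -> bool) (n : nat) : nat :=
  if n is m.+1 then numb a m + a m * 2 ^ m else 0.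

Lemma numb_lt a n : numb a n < 2 ^ n.
Proof.
elim: n => //= n ih; rewrite expnS; case: (a n) => /=; lia.
Qed.

Lemma bitn_numb a n i : i < n -> bitn (numb a n) i = a i.
Proof.
elim: n => //= n ih; rewrite ltnS leq_eqVlt => /orP[/eqP ->|i_n].
  rewrite /bitn divnDMl ?expn_gt0 // divn_small ?numb_lt // add0n.
  by case: (a n).
case: (a n); last by rewrite mul0n addn0 ih.
by rewrite mul1n addnC bitn_addX // ih.
Qed.

Lemma bitn_inj n w w' : w < 2 ^ n -> w' < 2 ^ n ->
  (forall i, i < n -> bitn w i = bitn w' i) -> w = w'.
Proof.
(* The residue modulo [2 ^ m] is assembled from the lowest [m] bits. *)
have numbK v m : v %% 2 ^ m = numb (bitn v) m.
  elim: m => [|m ih] /=; first by rewrite modn1.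
  rewrite -ih /bitn -modn2.
  have h := divn_eq (v %/ 2 ^ m) 2; have h2 := divn_eq v (2 ^ m).
  rewrite {1}h2 {1}h mulnDl -mulnA -expnS -addnA modnMDl modn_small; first lia.
  have : v %% 2 ^ m < 2 ^ m by rewrite ltn_mod expn_gt0.
  have : v %/ 2 ^ m %% 2 < 2 by rewrite ltn_mod.
  rewrite expnS; case: (_ %% 2) => [|[|//]] _; lia.
move=> wn wn' h; rewrite -(modn_small wn) -(modn_small wn') !numbK.
elim: n h {wn wn'} => //= n ih h; rewrite h // ih // => i i_n.
by apply: h; exact: ltnW.
Qed.

(* The constants satisfy [k * cap k * 2 ^ k < 2 ^ width k] (some candidate
   survives), [reps k / 2 ^ width k = 2 ^- (k + 2)] (it is rarely a block) and
   [reps k * cap k / 2 ^ width k = 2 ^ k] (missing [cap k] candidates is rare). *)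
Definition cap (k : nat) : nat := 2 ^ (2 * k + 2).
Definition width (k : nat) : nat := 4 * k + 2.
Definition reps (k : nat) : nat := 2 ^ (3 * k).

(** Consecutive entries [b' :: b] are the stages at which a candidate was dropped and at which it
    came up. It is a hit if the program had answered on [<k, b>] by stage [b'], whether or not the
    cap was reached. *)
Fixpoint hits (a : nat -> bool) (c k : nat) (l : seq nat) : nat :=
  if l is b' :: l' then
    (if l' is b :: _ then halts_in a b' c (pairn k b) : nat else 0)
    + hits a c k l'
  else 0.

Lemma hits_cons a c k b' b l : hits a c k (b' :: b :: l) =
  halts_in a b' c (pairn k b) + hits a c k (b :: l).
Proof. by []. Qed.

Definition threat (k : nat) (l : seq nat) (s c : nat) (a : nat -> bool) : bool :=
  halts_in a s c (pairn k (head 0 l)) && (hits a c k l < cap k).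

Definition kills (k : nat) (l : seq nat) (s : nat) : bool :=
  has (fun c =>
    2 ^ s < 2 ^ k * count (fun w => threat k l s c (bitn w)) (iota 0 (2 ^ s)))
    (iota 0 k).

(* The stages at which candidates of level [k] came up before stage [s], latest
   first; the current candidate is the number of its predecessors. *)
Fixpoint hist (k s : nat) : seq nat :=
  if s is s'.+1 then
    if kills k (hist k s') s' then s' :: hist k s' else hist k s'
  else [:: 0].

Definition cand (k s : nat) : nat := (size (hist k s)).-1.

Lemma hist_cons k s : exists b l, hist k s = b :: l.
Proof.
elim: s => [|s [b [l ih]]] /=; first by exists 0, [::].
by case: ifP => _; [exists s, (hist k s) | exists b, l].
Qed.

Lemma hist_le k s b : b \in hist k s -> b <= s.
Proof.
elim: s => [|s ih] /=; first by rewrite inE => /eqP ->.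
case: ifP => _; last by move=> /ih /leqW.
by rewrite inE => /orP[/eqP ->//|/ih /leqW].
Qed.

(** A kill at stage [b] puts [b] on the list for stage [b.+1], hence the strict lower bound. *)
Lemma hist_const k s g : head 0 (hist k s) < g <= s -> hist k g = hist k s.
Proof.
elim: s => [|s ih] /=; first by rewrite leqn0 => /andP[_ /eqP ->].
case: ifP => /= kl /andP[hg]; rewrite leq_eqVlt => /orP[/eqP ->|].
- by rewrite /= kl.
- by move=> gs; exfalso; lia.
- by rewrite /= kl.
- by move=> gs; apply: ih; rewrite hg.
Qed.

Lemma size_histS k s : size (hist k s.+1) = kills k (hist k s) s + size (hist k s).
Proof. by rewrite /=; case: ifP. Qed.

Lemma eq_hits a a' c k l s : (forall b, b \in l -> b <= s) ->
  (forall i, i < s -> a i = a' i) -> hits a c k l = hits a' c k l.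
Proof.
move=> + aa; elim: l => [//|b' l ih] h.
have {}ih : hits a c k l = hits a' c k l.
  by apply: ih => b bl; apply: h; rewrite inE bl orbT.
case: l ih h => [//|b l] ih h; rewrite !hits_cons ih (@eq_halts_in a a') //.
by move=> i ib; apply: aa; apply: leq_trans ib (h _ (mem_head _ _)).
Qed.

Lemma eq_threat a a' c k s s' : s <= s' -> (forall i, i < s' -> a i = a' i) ->
  threat k (hist k s) s' c a = threat k (hist k s) s' c a'.
Proof.
move=> ss aa; rewrite /threat (eq_halts_in _ _ aa).
by congr (_ && (_ < _)); apply: eq_hits aa => b /hist_le bs; exact: leq_trans ss.
Qed.

Lemma hits_histS a c k s : kills k (hist k s) s ->
  hits a c k (hist k s.+1) =
    halts_in a s c (pairn k (head 0 (hist k s))) + hits a c k (hist k s).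
Proof. by move=> /= ->; have [b [l ->]] := hist_cons k s; rewrite hits_cons. Qed.

(** Each counted threat also adds a hit, and a threat requires fewer than [cap k] earlier hits. The
    two bounds are carried through the induction together. *)
Lemma sum_threat a c k s :
  \sum_(0 <= i < s) (kills k (hist k i) i && threat k (hist k i) i c a)
    <= minn (cap k) (hits a c k (hist k s)).
Proof.
pose F i : nat := kills k (hist k i) i && threat k (hist k i) i c a.
rewrite -/(\sum_(0 <= i < s) F i); elim: s => [|s ih]; first by rewrite big_geq.
have -> : \sum_(0 <= i < s.+1) F i = \sum_(0 <= i < s) F i + F s.
  by rewrite big_nat_recr.
rewrite {2}/F; case kl: (kills k (hist k s) s); last first.
  have -> : hist k s.+1 = hist k s by rewrite /= kl.
  by rewrite andFb [nat_of_bool false]/= addn0.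
rewrite (hits_histS _ _ kl); move: ih; rewrite /threat andTb.
set B := \sum_(_ <= _ < _) _; case: halts_in; rewrite ?andTb ?andFb; lia.
Qed.

Lemma cand_sum k s : cand k s = \sum_(0 <= i < s) kills k (hist k i) i.
Proof.
elim: s => [|s ih]; first by rewrite big_geq.
rewrite big_nat_recr // -ih /cand size_histS.
by have [b [l ->]] := hist_cons k s; rewrite addnC.
Qed.

(* Each kill uses up measure more than [2 ^- k] of threats, and each oracle
   poses at most [cap k] threats for each of the [k] programs. *)
Lemma cand_lt k s : cand k s < 2 ^ width k.
Proof.
have T : 2 ^ s * cand k s <= 2 ^ k * (2 ^ s * (k * cap k)).
  have : 2 ^ k * \sum_(w <- iota 0 (2 ^ s)) \sum_(c <- iota 0 k)
     \sum_(0 <= i < s) (kills k (hist k i) i && threat k (hist k i) i c (bitn w))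
     <= 2 ^ k * (2 ^ s * (k * cap k)).
    rewrite leq_pmul2l ?expn_gt0 //.
    apply: leq_trans (leq_sum_size _ _) _; last by rewrite size_iota.
    move=> w; apply: leq_trans (leq_sum_size _ _) _; last by rewrite size_iota.
    by move=> c; exact: leq_trans (sum_threat _ _ _ _) (geq_minl _ _).
  (* Double counting: the same triple sum, scaled by [2 ^ k] and taken stage by stage, is at least
     [2 ^ s] per kill. *)
  apply: leq_trans.
  rewrite cand_sum !big_distrr /=.
  under [X in _ <= X]eq_bigr do rewrite exchange_big /= big_distrr /=.
  rewrite [X in _ <= X]exchange_big /= big_nat [X in _ <= X]big_nat.
  apply: leq_sum => i /= i_s.
  case kl: (kills k (hist k i) i); last by rewrite muln0.
  rewrite muln1; move: (kl) => /hasP [c ck].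
  have -> : s = i + (s - i) by lia.
  set d := s - i; rewrite expnD => h.
  (* The kill at stage [i] was decided on words of length [i]; [count_scale] restates it for words
     of length [s]. *)
  apply: (@leq_trans (2 ^ k * count (fun w => threat k (hist k i) i c (bitn w))
    (iota 0 (2 ^ (i + d))))).
    rewrite count_scale; last first.
      by move=> w w' ww; exact: eq_threat.
    by rewrite mulnCA mulnC leq_mul2l ltnW ?orbT.
  rewrite -big_distrr /= leq_mul2l countE; apply/orP; right.
  rewrite expnD; apply: leq_sum => w _.
  by rewrite (big_rem c) //= leq_addr.
have : cand k s <= 2 ^ k * (k * cap k).
  by rewrite -(@leq_pmul2l (2 ^ s)) ?expn_gt0 // mulnCA.
move=> /leq_ltn_trans; apply; rewrite /cap /width.
rewrite (_ : 4 * k + 2 = k + (k + (2 * k + 2))); last by lia.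
rewrite (expnD 2 k (k + _)) (expnD 2 k (2 * k + 2)) ltn_pmul2l ?expn_gt0 //.
by rewrite ltn_pmul2r ?expn_gt0 // ltn_expl.
Qed.

Definition stable (k s : nat) : Prop :=
  forall s', s <= s' -> hist k s' = hist k s.

(** The candidate index is bounded by [cand_lt]. At a stage where it is maximal no further kill can
    occur. *)
Lemma exists_stable k : exists s, stable k s.
Proof.
pose P n := `[< exists s, cand k s = n >].
have exP : exists n, P n by exists (cand k 0); apply/asboolP; exists 0.
have ubP n : P n -> n <= 2 ^ width k.
  by move=> /asboolP [s <-]; exact: ltnW (cand_lt k s).
case: (ex_maxnP exP ubP) => n /asboolP [s <-] smax; exists s.
move=> s' /subnKC <-; elim: (s' - s) => [|d ih]; first by rewrite addn0.
rewrite addnS /= ih; case: ifP => // kl.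
have /smax : P (cand k (s + d).+1) by apply/asboolP; exists (s + d).+1.
by rewrite /cand size_histS ih kl; have [b [l ->]] := hist_cons k s; rewrite /= ltnn.
Qed.

Lemma stableS k s s' : stable k s -> s <= s' -> stable k s'.
Proof.
by move=> st ss u su; rewrite (st _ ss) (st u) // (leq_trans ss).
Qed.

Lemma stable_nokill k s : stable k s -> ~~ kills k (hist k s) s.
Proof.
move=> /(_ s.+1 (leqnSn _)) /(congr1 size); rewrite size_histS.
by case: kills => //=; lia.
Qed.

(** Distinct hits concern distinct candidates, so the number of hits becomes the size of a set of
    candidates, each with the interval of stages during which it was current. *)
Lemma hit_candidates a c k s : exists J : seq nat,
  [/\ uniq J, size J = hits a c k (hist k s) & forall j, j \in J ->
    j < cand k s /\ exists b b', halts_in a b' c (pairn k b) /\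
      forall g, b < g <= b' -> cand k g = j].
Proof.
elim: s => [|s [J [uJ sJ hJ]]]; first by exists [::].
case kl: (kills k (hist k s) s); last by exists J; rewrite /cand /= kl.
have szS : cand k s.+1 = (cand k s).+1.
  rewrite /cand size_histS kl; by have [b [l ->]] := hist_cons k s.
rewrite (hits_histS _ _ kl); case ha: halts_in; last first.
  exists J; split=> // j /hJ [jc e]; split=> //; by rewrite szS ltnW.
exists (cand k s :: J); split => [||j].
- by rewrite /= uJ andbT; apply/negP => /hJ []; rewrite ltnn.
- by rewrite /= sJ.
rewrite inE => /orP[/eqP ->|/hJ [jc e]]; last first.
  by split=> //; rewrite szS ltnW.
split; first by rewrite szS.
exists (head 0 (hist k s)), s; split=> // g /hist_const.
by rewrite /cand => ->.
Qed.

(** * Computability of the construction *)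

Definition encode (l : seq nat) : nat := foldr (fun b z => (pairn b z).+1) 0 l.

(** The first component is the current candidate and also the number of consecutive pairs over which
    [hits] sums. *)
Definition history_num (l : seq nat) : nat := pairn (size l).-1 (encode l).

Definition tail_num (z : nat) : nat := sndn z.-1.

Definition nthn (z i : nat) : nat := fstn (iter i tail_num (sndn z)).-1.

Lemma nthn_history l i : nthn (history_num l) i = nth 0 l i.
Proof.
(* Past the end the code stays [0], whose first component is the default [0] of [nth]. *)
have dec0 n : iter n tail_num 0 = 0 by exact: iter_fix.
rewrite /nthn sndn_pair; elim: l i => [|b l ih] i.
  by rewrite dec0 nth_nil.
case: i => [|i]; first by rewrite /= fstn_pair.
rewrite iterSr [RHS]/= -ih; congr (fstn (iter i tail_num _).-1).
exact: sndn_pair.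
Qed.

(** This and the next two definitions copy [hits], [kills] and [hist] to coded histories, using
    operations that have a [recf] lemma. *)
Definition hitsn (w c k z : nat) : nat :=
  count (fun i => halts_in (bitn w) (nthn z i) c (pairn k (nthn z i.+1)))
    (iota 0 (fstn z)).

Definition killsn (k z s : nat) : bool :=
  has (fun c => 2 ^ s < 2 ^ k * count (fun w =>
      halts_in (bitn w) s c (pairn k (nthn z 0)) && (hitsn w c k z < cap k))
    (iota 0 (2 ^ s))) (iota 0 k).

Definition histn (k s : nat) : nat :=
  iteri s (fun i z => if killsn k z i then pairn (fstn z).+1 (pairn i (sndn z)).+1
                      else z) (pairn 0 (pairn 0 0).+1).

Lemma hitsn_history w c k l : hitsn w c k (history_num l) = hits (bitn w) c k l.
Proof.
rewrite /hitsn fstn_pair.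
under eq_count do rewrite !nthn_history.
elim: l => [//|b' [//|b l] ih]; rewrite hits_cons -ih.
rewrite -[iota 0 _]/(0 :: iota (1 + 0) (size l)) iotaDl.
by rewrite [LHS]/= count_map.
Qed.

Lemma killsn_history k l s : killsn k (history_num l) s = kills k l s.
Proof.
apply: eq_has => c; congr (_ < _ * _); apply: eq_count => w.
by rewrite /threat hitsn_history nthn_history nth0.
Qed.

Lemma histnE k s : histn k s = history_num (hist k s).
Proof.
elim: s => [//|s ih]; rewrite [LHS]/= -/(histn k s) ih killsn_history /hist -/hist.
case: ifP => // _; rewrite /history_num !pairnE.
by have [b [l ->]] := hist_cons k s.
Qed.

Lemma fstn_histn k s : fstn (histn k s) = cand k s.
Proof. by rewrite histnE fstn_pair. Qed.

Lemma recf_nthn Z I : recf Z -> recf I -> recf (fun A x => nthn (Z A x) (I A x)).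
Proof. by move=> rZ rI; rewrite /nthn /tail_num; recf. Qed.

Lemma recf_hitsn W C K Z : recf W -> recf C -> recf K -> recf Z ->
  recf (fun A x => hitsn (W A x) (C A x) (K A x) (Z A x)).
Proof.
move=> rW rC rK rZ; rewrite /hitsn; recf.
by apply: recf_halts_in; recf; apply: recf_nthn; recf.
Qed.

Lemma recf_killsn K Z S : recf K -> recf Z -> recf S ->
  recf (fun A x => killsn (K A x) (Z A x) (S A x)).
Proof.
move=> rK rZ rS; rewrite /killsn /cap; recf.
  by apply: recf_halts_in; recf; apply: recf_nthn; recf.
by apply: recf_hitsn; recf.
Qed.

Lemma recf_histn K S : recf K -> recf S -> recf (fun A x => histn (K A x) (S A x)).
Proof.
move=> rK rS; rewrite /histn; apply: recf_iteri => //; first by recf.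
by recf; apply: recf_killsn; recf.
Qed.

(** * The functional [Phi] and questions to the jump *)

Definition is_block (X : nat -> bool) (k j : nat) : bool :=
  has (fun i => all (fun r => X (i * width k + r) == bitn j r)
    (iota 0 (width k))) (iota 0 (reps k)).

Definition avoids (X : nat -> bool) (n s : nat) : bool :=
  (sndn n < s) && ~~ is_block X (fstn n) (cand (fstn n) s).

(** This code computes [Phi]: an unbounded search, which converges on those [n] for which some stage
    avoids. *)
Lemma exists_avoider : exists c, forall X n s,
  eval X c n s <-> avoids X n s /\ forall m, m < s -> ~~ avoids X n m.
Proof.
apply: (recf_mu (P := avoids)); rewrite /avoids /is_block /width /reps.
have rI : recf (fun _ p => histn (fstn (fstn p)) (sndn p)).
  by apply: recf_histn; recf.
apply: (@eq_recf (fun A p =>  (sndn (fstn p) < sndn p) && ~~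
  has (fun i => all (fun r => A (i * (4 * fstn (fstn p) + 2) + r)
     == bitn (fstn (histn (fstn (fstn p)) (sndn p))) r)
    (iota 0 (4 * fstn (fstn p) + 2))) (iota 0 (2 ^ (3 * fstn (fstn p)))))).
  by move=> A p; rewrite fstn_histn.
by recf; apply: recf_histn; recf.
Qed.

Lemma recf_semidecidable (P : (nat -> bool) -> nat -> nat -> bool) :
  recf (fun A p => P A (fstn p) (sndn p)) ->
  exists c, forall A x, halts A c x <-> exists y, P A x y.
Proof.
move=> /recf_mu [c cP]; exists c => A x; split=> [[y /cP [Py _]]|exP].
  by exists y.
case: (ex_minnP exP) => y Py miny; exists y; apply/cP; split=> // m my.
by apply/negP => /miny; rewrite leqNgt my.
Qed.

Definition const_code (v : nat) : code := iter v (CComp CSucc) CZero.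

Lemma eval_const_code A v x y : eval A (const_code v) x y <-> y = v.
Proof.
elim: v y => [//|v ih] y /=; split=> [[z [/ih -> ->]]//|->].
by exists v; split=> //; apply/ih.
Qed.

Definition const_num (v : nat) : nat :=
  iter v (fun z => pairn 6 (pairn (pairn 1 0) z)) (pairn 0 0).

Lemma code_num_const v : code_num (const_code v) = const_num v.
Proof. by elim: v => //= v ->. Qed.

(** The jump only asks about programs run on their own number. Composition with a constant program
    discards that input in favour of [v]. *)
Lemma zero_jumpE d v :
  zero_jump (pairn 6 (pairn (code_num d) (const_num v)))
  <-> halts (fun=> false) d v.
Proof.
have <- : code_num (CComp d (const_code v)) =
  pairn 6 (pairn (code_num d) (const_num v)) by rewrite /= code_num_const.
split=> [/asboolP [e [/code_num_inj -> [y [z [/eval_const_code -> h]]]]]|[y h]].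
  by exists y.
apply/asboolP; exists (CComp d (const_code v)); split=> //.
by exists y, v; split=> //; apply/eval_const_code.
Qed.

(** Histories only grow, so watching their length suffices; this replaces lists by numbers. *)
Lemma stableE k s : stable k s <-> forall d, cand k (s + d) = cand k s.
Proof.
split=> [h d|h s' /subnKC <-]; first by rewrite /cand h // leq_addr.
elim: (s' - s) => [|d ih]; first by rewrite addn0.
have : cand k (s + d).+1 = cand k (s + d) by rewrite -addnS !h.
have [b [l E]] := hist_cons k (s + d).
rewrite /cand size_histS addnS [hist k _.+1]/=; case: (kills _ _ _) => //=.
by rewrite E /=; lia.
Qed.

(** Instability is semidecidable, by searching for a later change of candidate. Stability is
    therefore one negative query to the jump. *)
Lemma exists_stability_query : exists d, forall k s,
  stable k s <-> ~~ zero_jump (pairn 6 (pairn (code_num d) (const_num (pairn k s)))).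
Proof.
pose P (A : nat -> bool) x y :=
  fstn (histn (fstn x) (sndn x + y)) != fstn (histn (fstn x) (sndn x)).
have [|d dP] := @recf_semidecidable P.
  by rewrite /P; recf; apply: recf_histn; recf.
exists d => k s; split=> [/stableE h|/negP h].
  apply/negP => /zero_jumpE /dP [y].
  by rewrite /P !pairnE !fstn_histn h eqxx.
apply/stableE => y; apply/eqP/negPn/negP => hy; apply: h.
by apply/zero_jumpE/dP; exists y; rewrite /P !pairnE !fstn_histn.
Qed.

(** * Length and bits of a numbered string, and the code of the test *)

Lemma string_num_cons b s : (string_num (b :: s)).+1 = (string_num s).+1.*2 + b.
Proof. by rewrite /= doubleS addSn. Qed.

Lemma string_num_bounds s :
  2 ^ size s <= (string_num s).+1 < 2 ^ (size s).+1.
Proof.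
elim: s => [//|b s ih]; rewrite string_num_cons /= [2 ^ _.+2]expnS.
move: ih; rewrite expnS; case: b => /=; lia.
Qed.

(** In binary, [(string_num s).+1] consists of the bits of [s], lowest first, topped by a leading
    1. *)
Lemma bitn_string_num s i : i < size s -> bitn (string_num s).+1 i = nth false s i.
Proof.
elim: s i => [//|b s ih] i; rewrite string_num_cons; case: i => [|i] /=.
  by move=> _; rewrite /bitn divn1 oddD odd_double; case: b.
rewrite ltnS => /ih <-; rewrite /bitn expnS divnMA.
congr (odd (_ %/ _)); rewrite divn2 halfD doubleK odd_double /=.
by case: b; lia.
Qed.

(** The binary logarithm of [x.+1], rounded down. *)
Definition string_size (x : nat) : nat :=
  count (fun i => 2 ^ i.+1 <= x.+1) (iota 0 x).

Lemma string_size_num s : string_size (string_num s) = size s.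
Proof.
have /andP[lo hi] := string_num_bounds s.
have szle : size s <= string_num s.
  by rewrite -ltnS; apply: leq_trans lo; exact: ltn_expl.
rewrite /string_size (eq_count (a2 := fun i => i < size s)); last first.
  move=> i; apply/idP/idP => [h|h].
    have := leq_ltn_trans h hi; rewrite ltn_exp2l //; lia.
  by apply: leq_trans lo; rewrite leq_exp2l.
move: szle => /subnKC <-; rewrite iotaD count_cat.
rewrite (eq_in_count (a2 := predT)); last by move=> i; rewrite mem_iota.
rewrite (eq_in_count (s := iota _ (_ - _)) (a2 := pred0)); last first.
  by move=> i; rewrite mem_iota add0n => /andP[+ _]; rewrite leqNgt => /negbTE.
by rewrite count_predT count_pred0 size_iota addn0.
Qed.

(** Stability costs one query and the threat is decidable outright, so the condition on the string
    is even decidable from the jump. *)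
Lemma exists_threat_code c a : exists e, forall n (s : seq bool),
  halts zero_jump e (pairn n (string_num s)) <->
  stable (n + a) (size s) /\
  threat (n + a) (hist (n + a) (size s)) (size s) c (nth false s).
Proof.
have [d dP] := exists_stability_query.
pose P (A : nat -> bool) k s x := ~~ A (pairn 6 (pairn (code_num d)
      (const_num (pairn k s)))) &&
  (halts_in (bitn x.+1) s c (pairn k (nthn (histn k s) 0)) &&
  (hitsn x.+1 c k (histn k s) < cap k)).
(* The predicate ignores the searched value, so the program halts exactly where it holds. *)
have [|e eP] := @recf_semidecidable
    (fun A p _ => P A (fstn p + a) (string_size (sndn p)) (sndn p)).
  rewrite /P /const_num /string_size /cap; recf.
  - by apply: recf_halts_in; recf; apply: recf_nthn; recf; apply: recf_histn; recf.
  - by apply: recf_hitsn; recf; apply: recf_histn; recf.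
exists e => n s; rewrite eP !pairnE string_size_num.
have -> : P zero_jump (n + a) (size s) (string_num s) =
    ~~ zero_jump (pairn 6 (pairn (code_num d) (const_num (pairn (n + a) (size s)))))
    && threat (n + a) (hist (n + a) (size s)) (size s) c (nth false s).
  rewrite -(@eq_threat (bitn (string_num s).+1)) //; last exact: bitn_string_num.
  by rewrite /P histnE hitsn_history nthn_history nth0.
by split=> [[_ /andP[/dP]]|[/dP -> ->]] //; exists 0.
Qed.

(** * Counting and measure *)

(** Independence in counting form: [u] is the low digit and [v] the high digit in base [m]. *)
Lemma count_mul (P P1 P2 : pred nat) m n :
  (forall u v, u < m -> v < n -> P (v * m + u) = P1 u && P2 v) ->
  count P (iota 0 (n * m)) = count P1 (iota 0 m) * count P2 (iota 0 n).
Proof.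
elim: n => [|n ih] hP; first by rewrite muln0.
have {}ih := ih (fun u v um vn => hP u v um (ltnW vn)).
rewrite mulSn addnC iotaD count_cat ih -[n.+1]addn1 iotaD count_cat mulnDr add0n.
congr (_ + _); have -> : iota (n * m) m = map (addn (n * m)) (iota 0 m).
  by rewrite -iotaDl addn0.
rewrite count_map (eq_in_count (a2 := fun u => P1 u && P2 n)); last first.
  by move=> u; rewrite mem_iota /= => um; exact: hP.
rewrite /= addn0; case: (P2 n); rewrite ?muln1 ?muln0.
  by apply: eq_count => u; rewrite andbT.
by rewrite -[RHS](count_pred0 (iota 0 m)); apply: eq_count => u; rewrite andbF.
Qed.

Definition block (X : nat -> bool) (k i : nat) : nat :=
  numb (fun r => X (i * width k + r)) (width k).

Lemma eq_numb a a' n : (forall i, i < n -> a i = a' i) -> numb a n = numb a' n.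
Proof.
elim: n => //= n ih h; rewrite h // ih // => i i_n; apply: h; exact: ltnW.
Qed.

Lemma eq_block X Y k i :
  (forall r, r < width k -> X (i * width k + r) = Y (i * width k + r)) ->
  block X k i = block Y k i.
Proof. by move=> h; apply: eq_numb => r /h. Qed.

Lemma numb_bitn w n : w < 2 ^ n -> numb (bitn w) n = w.
Proof.
move=> wn; apply: (@bitn_inj n) => //; first exact: numb_lt.
by move=> i i_n; rewrite bitn_numb.
Qed.

Lemma is_blockP X k j : j < 2 ^ width k ->
  reflect (exists2 i, i < reps k & block X k i = j) (is_block X k j).
Proof.
move=> jw; apply: (iffP hasP) => [[i]|[i ik <-]].
  rewrite mem_iota => /= ik /allP h; exists i => //.
  rewrite -(numb_bitn jw); apply: eq_numb => r rw.
  by apply/eqP/h; rewrite mem_iota.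
exists i; first by rewrite mem_iota.
by apply/allP => r; rewrite mem_iota => /= rw; rewrite bitn_numb.
Qed.

Definition misses (k : nat) (J : seq nat) (n : nat) (X : nat -> bool) : bool :=
  all (fun i => block X k i \notin J) (iota 0 n).

Lemma eq_misses k J n X Y : (forall i, i < n * width k -> X i = Y i) ->
  misses k J n X = misses k J n Y.
Proof.
move=> h; apply: eq_in_all => i; rewrite mem_iota /= => i_n; rewrite (@eq_block X Y) //.
move=> r rw; apply: h; apply: leq_trans (leq_mul i_n (leqnn (width k))).
by rewrite mulSn; lia.
Qed.

Lemma bitn_mulD v w m i : w < 2 ^ m ->
  bitn (v * 2 ^ m + w) i = if i < m then bitn w i else bitn v (i - m).
Proof.
move=> wm; case: ltnP => im.
  have [d ->] : exists d, m = d.+1 + i by exists (m - i).-1; lia.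
  rewrite /bitn expnD mulnA divnDl ?dvdn_mull // mulnK ?expn_gt0 //.
  by rewrite oddD oddM oddX /= andbF.
rewrite /bitn -{1}(subnKC im) expnD divnMA divnMDl ?expn_gt0 //.
by rewrite (divn_small wm) addn0.
Qed.

(** The topmost block varies independently of the lower ones and has [2 ^ width k - size J]
    admissible values. *)
Lemma count_misses k J n : uniq J -> (forall j, j \in J -> j < 2 ^ width k) ->
  count (fun w => misses k J n (bitn w)) (iota 0 (2 ^ (n * width k)))
    = (2 ^ width k - size J) ^ n.
Proof.
move=> uJ hJ; elim: n => [//|n ih].
have cJ : count (fun v => v \notin J) (iota 0 (2 ^ width k)) = 2 ^ width k - size J.
  have pJ : perm_eq [seq j <- iota 0 (2 ^ width k) | j \in J] J.
    apply: uniq_perm => [||j]; rewrite ?filter_uniq ?iota_uniq //.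
    by rewrite mem_filter mem_iota /=; case: (boolP (j \in J)) => // /hJ.
  have := count_predC (mem J) (iota 0 (2 ^ width k)).
  have szJ : count (mem J) (iota 0 (2 ^ width k)) = size J.
    by rewrite -(perm_size pJ) size_filter.
  by rewrite szJ size_iota => h; rewrite -[X in X - _]h addKn.
rewrite mulSn expnD (@count_mul _ (fun w => misses k J n (bitn w))
   (fun v => v \notin J)) ?ih ?cJ ?expnSr //.
move=> u v uA vk; rewrite /misses -[n.+1]addn1 iotaD all_cat; congr (_ && _).
  apply: eq_in_all => i; rewrite mem_iota /= => i_n.
  rewrite (@eq_block _ (bitn u)) // => r rw; rewrite bitn_mulD // ifT //.
  by apply: leq_trans (leq_mul i_n (leqnn (width k))); rewrite mulSn; lia.
rewrite /= andbT; congr (~~ (_ \in J)); rewrite -{2}(numb_bitn vk).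
by apply: eq_numb => r rw; rewrite bitn_mulD // ltnNge leq_addr /= addKn.
Qed.

Import Order.TTheory GRing.Theory Num.Theory.
Import numFieldNormedType.Exports.
Local Open Scope classical_set_scope.
Local Open Scope ring_scope.

(** * Probabilities of the events, and the Martin-Loef test *)

Section measure.
Variable R : realType.
Local Notation mu := (fair_coin R).

Lemma cylinder_numb w n : (w < 2 ^ n)%N ->
  cylinder (mkseq (bitn w) n) = [set X | numb X n = w].
Proof.
move=> wn; apply/seteqP; split=> X; rewrite /cylinder /= size_mkseq => h.
  rewrite -(numb_bitn wn); apply: eq_numb => i i_n.
  by rewrite -(nth_mkseq false X i_n) h nth_mkseq.
by apply/eq_in_map => i; rewrite mem_iota -h => /= i_n; rewrite bitn_numb.
Qed.

Lemma measurable_cylinder s : measurable (cylinder s : set measurable_cantor).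
Proof. by apply: sub_sigma_algebra; exists s. Qed.

Lemma measure_numb_in n (s : seq nat) : uniq s ->
  (forall w, w \in s -> (w < 2 ^ n)%N) ->
  measurable ([set X | numb X n \in s] : set measurable_cantor) /\
  mu [set X | numb X n \in s] = ((size s)%:R * 2^-1 ^+ n)%:E.
Proof.
elim: s => [|w s ih].
  move=> _ _; rewrite (_ : [set _ | _] = set0) ?measure0 ?mul0r.
    by split=> //; exact: measurable0.
  by apply/seteqP; split.
rewrite cons_uniq => /andP[ws us] h.
have [|ms es] := ih us; first by move=> v vs; apply: h; rewrite inE vs orbT.
have wn : (w < 2 ^ n)%N by apply: h; exact: mem_head.
have -> : [set X : measurable_cantor | numb X n \in w :: s] =
    cylinder (mkseq (bitn w) n) `|` [set X | numb X n \in s].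
  rewrite cylinder_numb //; apply/seteqP; split=> X /=; rewrite inE.
    by move=> /orP[/eqP|]; [left|right].
  by move=> [->|->]; rewrite ?eqxx ?orbT.
split; first by apply: measurableU => //; exact: measurable_cylinder.
rewrite measureU //; last first.
- rewrite cylinder_numb //; apply/seteqP; split=> X //= [-> ].
  by apply/negP.
- exact: measurable_cylinder.
have := fair_coin_cylinder R (mkseq (bitn w) n); rewrite size_mkseq => E.
rewrite [X in (X + _)%E]E [X in (_ + X)%E]es -EFinD; congr EFin.
by rewrite /= -[(size s).+1%:R]natr1 mulrDl mul1r addrC.
Qed.

(** The event is a disjoint union of cylinders, one for each counted word; this turns counts into
    probabilities. *)
Lemma measure_event n (E : (nat -> bool) -> bool) :
  (forall X Y, (forall i, (i < n)%N -> X i = Y i) -> E X = E Y) ->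
  measurable ([set X | E X] : set measurable_cantor) /\
  mu [set X | E X] =
    ((count (fun w => E (bitn w)) (iota 0 (2 ^ n)))%:R * 2^-1 ^+ n)%:E.
Proof.
move=> hE; pose s := [seq w <- iota 0 (2 ^ n) | E (bitn w)].
have [||ms es] := @measure_numb_in n s.
- by rewrite filter_uniq // iota_uniq.
- by move=> w; rewrite mem_filter mem_iota => /andP[].
suff -> : [set X : measurable_cantor | E X] = [set X | numb X n \in s].
  by rewrite es size_filter.
apply/seteqP; split=> X /=; rewrite mem_filter mem_iota /= numb_lt andbT;
  by rewrite (hE X (bitn (numb X n))) // => i i_n; rewrite bitn_numb.
Qed.

Lemma stable_threat_grow k s s' c A : stable k s -> (s <= s')%N ->
  threat k (hist k s) s c A -> threat k (hist k s') s' c A.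
Proof.
move=> st ss; rewrite (st _ ss) /threat => /andP[h ->]; rewrite andbT.
exact: halts_in_grow h.
Qed.

Lemma bernoulli_lower (x : R) n : 0 <= x <= 1 -> 1 - n%:R * x <= (1 - x) ^+ n.
Proof.
move=> /andP[x0 x1]; elim: n => [|n ih]; first by rewrite mul0r subr0 expr0.
have n0 : 0 <= n%:R :> R by exact: ler0n.
have := ler_wpM2l (_ : 0 <= 1 - x) ih; rewrite -exprS subr_ge0 => /(_ x1).
apply: le_trans; rewrite -natr1; nra.
Qed.

(** The induction step rests on [(1 - x) * (1 + (n + 1) * x) <= 1 + n * x]. *)
Lemma bernoulli_upper (x : R) n : 0 <= x <= 1 -> (1 - x) ^+ n * (1 + n%:R * x) <= 1.
Proof.
move=> /andP[x0 x1]; elim: n => [|n ih]; first by rewrite mul0r addr0 expr0 mulr1.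
apply: le_trans ih; rewrite exprSr -mulrA; apply: ler_wpM2l.
  by apply: exprn_ge0; rewrite subr_ge0.
have n0 : 0 <= n%:R :> R by exact: ler0n.
by rewrite -natr1; nra.
Qed.

Lemma measure_misses k J : uniq J -> (forall j, j \in J -> (j < 2 ^ width k)%N) ->
  measurable ([set X | misses k J (reps k) X] : set measurable_cantor) /\
  mu [set X | misses k J (reps k) X] =
    ((1 - (size J)%:R / 2 ^+ width k) ^+ reps k)%:E.
Proof.
move=> uJ hJ; have [mE ->] := @measure_event (reps k * width k)
  (misses k J (reps k)) (@eq_misses k J (reps k)).
split=> //; congr EFin; rewrite count_misses // natrX mulnC exprM -exprMn.
have szJ : (size J <= 2 ^ width k)%N.
  rewrite -(size_iota 0 (2 ^ width k)); apply: uniq_leq_size => // j /hJ.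
  by rewrite mem_iota.
congr (_ ^+ _); rewrite natrB // natrX mulrBl exprVn mulfV //.
Qed.

(** Here [reps k] times the fraction covered by [J] is at least [2 ^ k], so [bernoulli_upper] bounds
    the probability by [1 / (1 + 2 ^ k)]. *)
Lemma measure_misses_cap k J : uniq J ->
  (forall j, j \in J -> (j < 2 ^ width k)%N) -> (cap k <= size J)%N ->
  (mu [set X | misses k J (reps k) X] <= (2^-1 ^+ k)%:E)%E.
Proof.
move=> uJ hJ capJ; have [_ ->] := measure_misses uJ hJ; rewrite lee_fin.
have szJ : (size J <= 2 ^ width k)%N.
  rewrite -(size_iota 0 (2 ^ width k)); apply: uniq_leq_size => // j /hJ.
  by rewrite mem_iota.
set x := _ / _.
have x01 : 0 <= x <= 1.
  rewrite divr_ge0 ?exprn_ge0 //= ler_pdivrMr ?exprn_gt0 // mul1r.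
  by rewrite -natrX ler_nat.
have := bernoulli_upper (reps k) x01.
have -> : 2^-1 ^+ k = (2 ^+ k)^-1 :> R by rewrite exprVn.
have p0 : 0 <= (1 - x) ^+ reps k.
  by apply: exprn_ge0; rewrite subr_ge0; case/andP: x01.
have rx : 2 ^+ k <= (reps k)%:R * x.
  rewrite /x mulrA ler_pdivlMr ?exprn_gt0 // -!natrX -!natrM ler_nat.
  apply: (@leq_trans (reps k * cap k)); last by rewrite leq_mul2l capJ orbT.
  by rewrite /reps /cap /width -!expnD leq_exp2l //; lia.
move=> h; rewrite -(ler_pM2r (exprn_gt0 k (ltr0Sn R 1))) mulVf ?expf_neq0 //.
apply: le_trans h; apply: ler_wpM2l => //; lra.
Qed.

(** The value [2 ^- (k + 2)] is written as a term of the geometric series with sum 1/2, over which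
    the levels are later added up. *)
Lemma measure_is_block k j : (j < 2 ^ width k)%N ->
  measurable ([set X | is_block X k j] : set measurable_cantor) /\
  (mu [set X | is_block X k j] <= (2^-1 / (2 ^ k.+1)%:R)%:E)%E.
Proof.
move=> jw.
have -> : [set X : measurable_cantor | is_block X k j] =
    ~` [set X | misses k [:: j] (reps k) X].
  apply/seteqP; split=> X /=.
    move=> /(is_blockP _ jw) [i ik <-] /allP /(_ i).
    by rewrite mem_iota inE eqxx => /(_ ik).
  move=> /negP /allPn [i]; rewrite mem_iota inE negbK => /= ik /eqP e.
  by apply/(is_blockP _ jw); exists i.
have hj i : i \in [:: j] -> (i < 2 ^ width k)%N by rewrite inE => /eqP ->.
have [mE E] := @measure_misses k [:: j] isT hj.
split; first exact: measurableC.
rewrite probability_setC // E -EFinB lee_fin.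
have x01 : 0 <= (1 / 2 ^+ width k : R) <= 1.
  rewrite divr_ge0 ?exprn_ge0 //= ler_pdivrMr ?exprn_gt0 // mul1r.
  by apply: exprn_ege1; rewrite ler1n.
have := bernoulli_lower (reps k) x01.
have -> : (reps k)%:R * (1 / 2 ^+ width k) = 2^-1 / (2 ^ k.+1)%:R :> R.
  rewrite mulrA mulr1 -invfM -natrM -expnS -natrX /reps /width.
  have -> : (4 * k + 2 = 3 * k + k.+2)%N by lia.
  rewrite expnD natrM invfM mulrA mulfV ?mul1r //.
by move=> h; rewrite [size _]/=; lra.
Qed.

(** At a stable stage nothing is killed, so the threshold of [kills] is not exceeded for [c]. *)
Lemma measure_threat k s c : stable k s -> (c < k)%N ->
  measurable ([set X | threat k (hist k s) s c X] : set measurable_cantor) /\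
  (mu [set X | threat k (hist k s) s c X] <= (2^-1 ^+ k)%:E)%E.
Proof.
move=> /stable_nokill /hasPn /(_ c); rewrite mem_iota /= => + ck.
move=> /(_ ck); rewrite -leqNgt => h.
have [mE E] := @measure_event s (threat k (hist k s) s c)
  (fun X Y => @eq_threat X Y c k s s (leqnn s)).
split=> //; rewrite [leLHS]E lee_fin !exprVn ler_pdivrMr ?exprn_gt0 // mulrC.
by rewrite ler_pdivlMr ?exprn_gt0 // mulrC -!natrX -natrM ler_nat.
Qed.

(** Any stable stage may serve, so membership is witnessed by a finite prefix of [X] that the jump
    can check. *)
Definition threatened (k c : nat) : set cantor_space :=
  [set X | exists2 s, stable k s & threat k (hist k s) s c X].

(** Beyond a stable stage the threats increase with the stage, so continuity from below transfers
    the bound to their union. *)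
Lemma measure_threatened k c : (c < k)%N ->
  (mu (threatened k c) <= (2^-1 ^+ k)%:E)%E.
Proof.
move=> ck; have [s0 st0] := exists_stable k.
pose F n : set measurable_cantor :=
  [set X | threat k (hist k (s0 + n)) (s0 + n) c X].
have st n : stable k (s0 + n) by apply: stableS st0 _; exact: leq_addr.
have mF n : measurable (F n) by have [] := measure_threat (st n) ck.
have -> : threatened k c = \bigcup_n F n.
  apply/seteqP; split=> [X [s sts h]|X [n _ h]]; last by exists (s0 + n)%N.
  exists s => //; apply: stable_threat_grow sts _ h; exact: leq_addl.
have ndF : {homo F : n m / (n <= m)%N >-> (n <= m)%O}.
  move=> n m nm; apply/subsetPset => X; apply: stable_threat_grow => //.
  by rewrite leq_add2l.
have mUF : measurable (\bigcup_n F n) by exact: bigcupT_measurable.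
have := nondecreasing_cvg_mu (mu := mu) mF mUF ndF.
move=> /cvge_to_le; apply; apply: nearW => n.
by have [] := measure_threat (st n) ck.
Qed.

(** The shift by [a] keeps the level above [c], so that [kills] monitors the program [c] there. *)
Lemma threatened_test c a : (c < a)%N ->
  martin_lof_test R zero_jump (fun n => threatened (n + a) c).
Proof.
move=> ca; split.
  have [e eP] := exists_threat_code c a; exists e => n.
  have thr X s : threat (n + a) (hist (n + a) s) s c X =
      threat (n + a) (hist (n + a) s) s c (nth false (mkseq X s)).
    by apply: eq_threat => // i i_s; rewrite nth_mkseq.
  apply/seteqP; split=> [X [s st h]|X [s /eP [st h] Xs]].
    exists (mkseq X s); last by rewrite /cylinder /= size_mkseq.
    by apply/eP; rewrite size_mkseq -thr.
  exists (size s); rewrite // thr (_ : mkseq X (size s) = s) //.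
move=> n; apply: le_trans (measure_threatened _) _; first lia.
by rewrite lee_fin ler_wiXn2l ?invr_ge0 ?invf_le1 ?ler1n // leq_addr.
Qed.

(** [G] escapes some level of the test although its program halts on the pair for the final
    candidate; only the cap can prevent the threat. *)
Lemma two_random_hits (G : cantor_space) c f a : two_random R G ->
  (forall n, eval G c n (f n)) ->
  exists k s, (a <= k)%N /\ (cap k <= hits G (code_num c) k (hist k s))%N.
Proof.
(* The shift [b] exceeds [code_num c], as the test requires, and makes the level at least [a]. *)
move=> rG fP; pose b := (a + (code_num c).+1)%N.
have cb : (code_num c < b)%N by rewrite /b; lia.
have /rG hG := threatened_test cb.
have [n nG] : exists n, ~ threatened (n + b) (code_num c) G.
  apply: contra_notP hG => h n _; apply: contrapT => h'.
  by apply: h; exists n.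
pose k := (n + b)%N; have [s st] := exists_stable k.
have [[s' hs'] _] := halts_in_eval (fP (pairn k (head 0%N (hist k s)))).
exists k, (s + s')%N; split; first by rewrite /k /b; lia.
rewrite leqNgt; apply/negP => h; apply: nG; exists (s + s')%N.
  by apply: stableS st _; exact: leq_addr.
rewrite /threat h andbT (st (s + s')%N) ?leq_addr //.
by apply: halts_in_grow hs' => //; exact: leq_addl.
Qed.

(** * Negligibility of the dominated sets *)

Lemma negligible_small (A : set measurable_cantor) :
  (forall n, exists B : set measurable_cantor,
    [/\ measurable B, A `<=` B & (mu B <= (2^-1 ^+ n)%:E)%E]) ->
  mu.-negligible A.
Proof.
move=> /choice [B hB]; have mB n : measurable (B n) by have [] := hB n.
apply: (@negligibleS _ _ _ mu (\bigcap_n B n)).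
  by move=> X AX n _; have [_ + _] := hB n; apply.
have mI : measurable (\bigcap_n B n) by exact: bigcapT_measurable.
apply/(negligibleP mu mI)/eqP; rewrite eq_le measure_ge0 andbT.
apply/lee_addgt0Pr => e e0; rewrite add0e.
pose n := (Num.truncn e^-1).+1.
apply: (@le_trans _ _ (mu (B n))).
  by apply: le_measure; rewrite ?inE // => X /(_ n); apply.
have [_ _ /le_trans] := hB n; apply; rewrite lee_fin exprVn.
rewrite -[e]invrK lef_pV2 ?posrE ?exprn_gt0 ?invr_gt0 //.
apply: le_trans (ltW (truncnS_gt _)) _.
by rewrite -natrX ler_nat ltnW // ltn_expl.
Qed.

(** The value of [g] at [<k, b>] lies above [b] and below that of [f], which is at most [b'] because
    the program had answered by then. At that stage [j] is current, and [g] stops only where the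
    current candidate is not a block. *)
Lemma dominated_misses X G c f g m k s J :
  (forall n, eval G c n (f n)) ->
  (forall n, avoids X n (g n)) ->
  (forall n, (m < n)%N -> (g n < f n)%N) -> (m < k)%N ->
  (forall j, j \in J -> (j < cand k s)%N /\
    exists b b', halts_in G b' (code_num c) (pairn k b) /\
      forall t, (b < t <= b')%N -> cand k t = j) ->
  misses k J (reps k) X.
Proof.
move=> fP gP gf mk hJ; apply/allP => i; rewrite mem_iota => /= ik.
apply/negP => /hJ [jc [b [b' [hb hcand]]]].
have [_ /(_ _ hb) fb'] := halts_in_eval (fP (pairn k b)).
have gfb := gf _ (leq_trans mk (leq_pairn k b)).
have := gP (pairn k b); rewrite /avoids !pairnE => /andP[bg /negP]; apply.
rewrite (hcand (g (pairn k b))); last by lia.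
have jw := ltn_trans jc (cand_lt k s).
by apply/(is_blockP _ jw); exists i.
Qed.

Lemma dominated_negligible (G : cantor_space) c m : two_random R G ->
  mu.-negligible [set X : measurable_cantor | exists g f,
    [/\ forall n, avoids X n (g n), forall n, eval G c n (f n) &
        forall n, (m < n)%N -> (g n < f n)%N]].
Proof.
move=> rG; have [[f fP]|nf] := pselect (exists f, forall n, eval G c n (f n)); last first.
  apply: negligibleS (negligible_set0 mu) => X [g [f [_ fP _]]].
  by apply: nf; exists f.
apply: negligible_small => n.
(* The level is to exceed [m], for the domination to apply, and to be at least [n], for the bound on
   the measure. *)
have [k [s [ak capk]]] := two_random_hits (n + m.+1) rG fP.
have [J [uJ sJ hJ]] := hit_candidates G (code_num c) k s.
have hJw j : j \in J -> (j < 2 ^ width k)%N.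
  by move=> /hJ [jc _]; exact: ltn_trans jc (cand_lt k s).
have [mM _] := measure_misses uJ hJw.
exists [set X | misses k J (reps k) X]; split=> //.
  move=> X [g [f' [gP f'P gf]]].
  by apply: (dominated_misses f'P gP gf _ hJ); lia.
apply: le_trans (measure_misses_cap uJ hJw _) _; first by rewrite sJ.
by rewrite lee_fin ler_wiXn2l ?invr_ge0 ?invf_le1 ?ler1n //; lia.
Qed.

End measure.

Theorem theorem3p9 (R : realType) (G : cantor_space) :
  two_random R G -> ~ ae_dominating R G.
Proof.
move=> rG aeG; pose mu := fair_coin R.
have [d dP] := exists_avoider; have [sk stk] := choice exists_stable.
pose E k : set measurable_cantor := [set X | is_block X k (cand k (sk k))].
have mE k : measurable (E k) by have [] := measure_is_block R (cand_lt k (sk k)).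
have mUE : measurable (\bigcup_k E k) by exact: bigcupT_measurable.
have leE : (mu (\bigcup_k E k) <= (2^-1)%:E)%E.
  apply: le_trans (measure_sigma_subadditive mu mE mUE (@subset_refl _ _)) _.
  apply: le_trans (epsilon_trick0 xpredT _); last by rewrite invr_ge0.
  apply: lee_nneseries => [k _ _|k _]; first exact: measure_ge0.
  by have [] := measure_is_block R (cand_lt k (sk k)).
(* Indexing by the number of the code makes the union over programs a countable union over [nat]. *)
pose P e m : set measurable_cantor := [set X | exists c g f, code_num c = e /\
  [/\ forall n, avoids X n (g n), forall n, eval G c n (f n) &
      forall n, (m < n)%N -> (g n < f n)%N]].
have nullP e m : mu.-negligible (P e m).
  have [[c ce]|nc] := pselect (exists c, code_num c = e); last first.
    apply: negligibleS (negligible_set0 mu) => X [c [g [f [ce _]]]].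
    by apply: nc; exists c.
  apply: negligibleS (dominated_negligible c m rG) => X [c' [g [f [c'e h]]]].
  have -> : c = c' by apply: code_num_inj; rewrite ce c'e.
  by exists g, f.
(* If no final candidate is a block of [X], then [Phi X] is total, so [X] either violates the
   domination property or lies in some [P e m]. *)
have : mu.-negligible (~` (\bigcup_k E k)).
  apply: negligibleS (negligibleU aeG
    (negligible_bigcup (fun e => negligible_bigcup (nullP e)))).
  move=> X XE; have [h|] := pselect (forall g, turing_le g X ->
      exists f, turing_le f G /\ fun_dominates f g); last by left.
  right; have exg n : exists s, avoids X n s.
    (* A stage after [sndn n] at which the candidate is already final. *)
    exists (maxn (sndn n).+1 (sk (fstn n))); rewrite /avoids leq_maxl /=.
    rewrite /cand (stk (fstn n)) ?leq_maxr // -/(cand _ _).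
    by apply/negP => h'; apply: XE; exists (fstn n).
  pose g n := ex_minn (exg n).
  have gP n : avoids X n (g n) by rewrite /g; case: ex_minnP.
  have [|f [[c fP] [m gf]]] := h g.
    exists d => n; apply/dP; split=> // s; rewrite /g; case: ex_minnP => t _ mint st.
    by apply/negP => /mint; rewrite leqNgt st.
  exists (code_num c) => //; exists m => //.
  by exists c, g, f; split.
(* A null complement would give the union measure 1, against the bound 1/2. *)
move=> /(negligibleP _ (measurableC mUE)).
move=> h0; have h := etrans (esym h0) (probability_setC mu mUE).
have U_E := fineK (fin_num_measure mu _ mUE).
move: leE h; rewrite -U_E lee_fin => leE /(congr1 fine) /=.
by move: leE; set r := fine _ => leE; lra.
Qed.
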